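(* Let $K$ be a complete, algebraically closed nonarchimedean valued field and let $\varphi(z)\in K(z)$ have degree $d\ge1$. Then $$\mathrm{Lip}_{\mathrm{Berk}}(\varphi)\le\max\Big(\frac{1}{\mathrm{GIR}(\varphi)\cdot B_0(\varphi)^d},\ \frac{d}{\mathrm{GIR}(\varphi)^{1/d}\cdot B_0(\varphi)}\Big).$$
   Context: $K$ is a complete, algebraically closed field with a nontrivial nonarchimedean absolute value $|\cdot|$; $\mathcal O=\{z\in K:|z|\le 1\}$. Fix $q>1$ and write $\log=\log_q$. $\mathbf P^1_{\mathrm{Berk}}$ is the Berkovich projective line over $K$: a uniquely path-connected tree containing $\mathbf P^1(K)=K\cup\{\infty\}$; for $a\in K$, $r>0$, $\zeta_{a,r}$ is the point corresponding to the disc $D(a,r)=\{z:|z-a|\le r\}$, $\zeta_{a,0}=a$, $\zeta_G=\zeta_{0,1}$ is the Gauss point; $[x,y]$ is the unique path, $(x,y]$ etc. the half-open paths. On $\mathbf H^1=\mathbf P^1_{\mathrm{Berk}}\setminus\mathbf P^1(K)$ the logarithmic path metric $\rho$ gives the path $\{\zeta_{a,r}:R_1\le r\le R_2\}$ length $\log(R_2/R_1)$. $\mathrm{diam}_G(x)=q^{-\rho(\zeta_G,x)}$ for $x\in\mathbf H^1$, $0$ for $x\in\mathbf P^1(K)$; explicitly $\mathrm{diam}_G(\zeta_{a,r})=r/\max(1,|a|,r)^2$. $x\vee_G y$ is the first point where $[x,\zeta_G]$ and $[y,\zeta_G]$ meet; $d(x,y)=2\,\mathrm{diam}_G(x\vee_G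 y)-\mathrm{diam}_G(x)-\mathrm{diam}_G(y)$. A nonconstant $\varphi\in K(z)$ acts continuously on $\mathbf P^1_{\mathrm{Berk}}$; $\mathrm{Lip}_{\mathrm{Berk}}(\varphi)=\sup_{x\ne y} d(\varphi(x),\varphi(y))/d(x,y)$. Gauss Image radius: $\mathrm{GIR}(\varphi)=\mathrm{diam}_G(\varphi(\zeta_G))$. For $a\in\mathbf P^1(K)$ and $0<r<1$ let $Q_{a,r}$ be the unique point of $[a,\zeta_G]$ with $\mathrm{diam}_G(Q_{a,r})=r$, and $\mathcal B(a,r)^-=\{x\in\mathbf P^1_{\mathrm{Berk}}:Q_{a,r}\in(x,\zeta_G]\}$; $\mathcal B(a,1)^-=\bigcup_{r<1}\mathcal B(a,r)^-$. Ball-Mapping radius: $B_0(\varphi)=\sup\{0<r\le1:\ \varphi(\mathcal B(a,r)^-)\ne\mathbf P^1_{\mathrm{Berk}}\text{ for all }a\in\mathbf P^1(K)\}$. *)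

(* Defs.v *)
From HB Require Import structures.
From mathcomp Require Import all_boot all_order all_algebra.
From Stdlib Require Import Reals ClassicalEpsilon.

Set Implicit Arguments.
Unset Strict Implicit.
Unset Printing Implicit Defensive.

Section Berk.
Variable K : closedFieldType.
Variable abs : K -> R.

Local Open Scope ring_scope.
Definition Kzero : K := 0.
Definition Kmul (x y : K) : K := x * y.
Definition Kadd (x y : K) : K := x + y.
Definition Ksub (x y : K) : K := x - y.
Definition Pmul (h k : {poly K}) : {poly K} := h * k.
Definition Padd (h k : {poly K}) : {poly K} := h + k.
Definition Pconst (c : K) : {poly K} := c%:P.
Definition Plin (a : K) : {poly K} := 'X - a%:P.
Definition Peval (h : {poly K}) (c : K) : K := h.[c].
(* homogenised composition g^(deg h) * h(f/g) *)
Definition comp_poly_rat (f g h : {poly K}) : {poly K} :=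
  \sum_(i < size h) (h`_i *: (f ^+ i * g ^+ ((size h).-1 - i))).
Definition value_at_infinity (f g : {poly K}) : K :=
  if ltn (size f) (size g) then 0 else lead_coef f / lead_coef g.
Local Close Scope ring_scope.

Local Open Scope R_scope.

Definition nonarch_complete_abs : Prop :=
  (forall x, 0 <= abs x) /\
  (forall x, abs x = 0 <-> x = Kzero) /\
  (forall x y, abs (Kmul x y) = abs x * abs y) /\
  (forall x y, abs (Kadd x y) <= Rmax (abs x) (abs y)) /\
  (exists x, abs x <> 0 /\ abs x <> 1) /\
  (forall u : nat -> K,
     (forall eps, 0 < eps -> exists N, forall m n, (N <= m)%nat -> (N <= n)%nat ->
        abs (Ksub (u m) (u n)) < eps) ->
     exists l, forall eps, 0 < eps -> exists N, forall n, (N <= n)%nat ->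
        abs (Ksub (u n) l) < eps).

(* Points of A^1_Berk: multiplicative seminorms on K[T] extending |.| *)
Definition is_seminorm (x : {poly K} -> R) : Prop :=
  (forall h, 0 <= x h) /\
  (forall h k, x (Pmul h k) = x h * x k) /\
  (forall h k, x (Padd h k) <= Rmax (x h) (x k)) /\
  (forall c, x (Pconst c) = abs c).

(* P^1_Berk = A^1_Berk plus the point infinity (None) *)
Definition bpoint := option ({poly K} -> R).

Definition is_berk (P : bpoint) : Prop :=
  match P with None => True | Some x => is_seminorm x end.

(* Domination order = tree order of P^1_Berk rooted at infinity *)
Definition le_b (P Q : bpoint) : Prop :=
  match P, Q with
  | _, None => True
  | None, Some _ => False
  | Some x, Some y => forall h, x h <= y h
  end.

Definition is_join (P Q J : bpoint) : Prop :=
  is_berk J /\ le_b P J /\ le_b Q J /\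
  (forall J', is_berk J' -> le_b P J' -> le_b Q J' -> le_b J J').

Definition bjoin (P Q : bpoint) : bpoint :=
  epsilon (inhabits None) (is_join P Q).

Definition median (P Q S : bpoint) : bpoint :=
  epsilon (inhabits None) (fun M =>
    (M = bjoin P Q \/ M = bjoin Q S \/ M = bjoin P S) /\
    le_b M (bjoin P Q) /\ le_b M (bjoin Q S) /\ le_b M (bjoin P S)).

Definition on_path (P Q M : bpoint) : Prop := median P Q M = M.

Definition gauss_norm (h : {poly K}) : R := foldr Rmax 0 (map abs h).
Definition zetaG : bpoint := Some gauss_norm.
Definition typeI (c : K) : bpoint := Some (fun h => abs (Peval h c)).

Definition radius (x : {poly K} -> R) : R :=
  epsilon (inhabits 0) (fun m =>
    (forall a, m <= x (Plin a)) /\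
    (forall m', (forall a, m' <= x (Plin a)) -> m' <= m)).

(* diam_G ; for zeta_{a,r} this is r / max(1,|a|,r)^2 *)
Definition diamG (P : bpoint) : R :=
  match P with
  | None => 0
  | Some x => radius x / (Rmax 1 (x (Plin Kzero))) ^ 2
  end.

Definition joinG (P Q : bpoint) : bpoint := median P Q zetaG.

Definition berk_dist (P Q : bpoint) : R :=
  2 * diamG (joinG P Q) - diamG P - diamG Q.

Definition push (f g : {poly K}) (x : {poly K} -> R) : {poly K} -> R :=
  fun h => x (comp_poly_rat f g h) / (x g) ^ ((size h).-1).

Definition phi_act (f g : {poly K}) (P : bpoint) : bpoint :=
  match P with
  | None =>
      if ltn (size g) (size f) then None
      else typeI (value_at_infinity f g)
  | Some x =>
      if Req_EM_T (x g) 0 then None else Some (push f g x)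
  end.

Definition GIR (f g : {poly K}) : R := diamG (phi_act f g zetaG).

Definition Qpt (a : bpoint) (r : R) : bpoint :=
  epsilon (inhabits None) (fun M => is_berk M /\ on_path a zetaG M /\ diamG M = r).

Definition ball_lt (a : bpoint) (r : R) (P : bpoint) : Prop :=
  on_path P zetaG (Qpt a r) /\ Qpt a r <> P.

Definition ballm (a : bpoint) (r : R) (P : bpoint) : Prop :=
  (r < 1 /\ ball_lt a r P) \/
  (1 <= r /\ exists r', 0 < r' < 1 /\ ball_lt a r' P).

Definition classical_point (a : bpoint) : Prop :=
  a = None \/ exists c, a = typeI c.

(* the set whose sup is B_0(phi) *)
Definition B0set (f g : {poly K}) (r : R) : Prop :=
  0 < r <= 1 /\
  forall a, classical_point a ->
    exists Y, is_berk Y /\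
      forall X, is_berk X -> ballm a r X -> phi_act f g X <> Y.

End Berk.

(* Main.v *)
(** A point [P] of the Berkovich line is encoded by the ultrametric norm [ell P] that
it induces on linear forms [u X + v Z], scaled so that [max(|X|, |Z|) = 1].  In these
terms [diam_G (P v_G Q)] is the infimum over unit forms of [max (ell P, ell Q)]; this
[join_diam] is ultrametric, so the distance satisfies the triangle inequality and it
suffices to bound [phi] along the segments [Q_{a,t}], [0 < t <= 1].  In a coordinate
centred at [a], [Q_{a,t}] is the Gauss norm [N_t], and where [N_t(g) = |g_i| t^i]
dominates [N_t(f)], subtracting a multiple of [g] from [f] gives [p] with [p_i = 0]
and [diam_G (phi Q_{a,t}) = max_j |p_j| t^(j-i) / |g_i|].  A dominant index [j] makes
this function have slope [n diam_G(phi Q_{a,t}) / t] with [n = |j - i| <= d].  For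
[t >= B_0] this is at most [d / B_0].  For [t < r < B_0] some combination [h] of [f] and
[g] has no zero in the disc of radius [r], hence [|h_0| >= |h_j| r^j], which gives
[GIR r^d max(N_1 f, N_1 g) <= |h_0|] and then the slope bound [n (GIR r^d)^(-1/n)];
this is largest at [n = 1] or [n = d]. *)

From HB Require Import structures.
From mathcomp Require Import all_boot all_order all_algebra.
From mathcomp Require Import boolp classical_sets topology normedtype.
From mathcomp Require Import Rstruct_topology.
From Stdlib Require Import Reals ClassicalEpsilon Lra.
From Stdlib Require Rminmax.
From Coquelicot Require Import Rcomplements.
Require Import Defs.

Set Implicit Arguments.
Unset Strict Implicit.
Unset Printing Implicit Defensive.

Import GRing.Theory Num.Theory.
Delimit Scope ring_scope with ring.
Delimit Scope nat_scope with N.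
Local Open Scope R_scope.

(* Innermost maxima first, so that no case hypothesis mentions another maximum. *)
Ltac rmax_lra :=
  repeat match goal with
  | |- context [Rmax ?a ?b] =>
    lazymatch a with context [Rmax _ _] => fail | _ =>
    lazymatch b with context [Rmax _ _] => fail | _ =>
    case: (Rminmax.R.max_spec a b) => [[? ->]|[? ->]] end end
  end; try (intros; lra).

(** * Real inequalities *)

Lemma le_nat_INR (m n : nat) : (m <= n)%N -> INR m <= INR n.
Proof. by move=> /leP; exact: le_INR. Qed.

Lemma INR_ge1 (n : nat) : (0 < n)%N -> 1 <= INR n.
Proof. exact: le_nat_INR. Qed.

Lemma Rmax_div (a b c : R) : 0 < c -> Rmax a b / c = Rmax (a / c) (b / c).
Proof. by move=> c0; apply/Rmult_max_distr_r/Rlt_le/Rinv_0_lt_compat. Qed.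

Lemma Rmax_eq1_mul_le (a b x : R) :
  Rmax a b = 1 -> 0 <= x <= 1 -> x <= Rmax (a * x) b.
Proof.
move=> ab x01; have := Rminmax.R.max_spec a b; rewrite ab => -[[_ <-]|[_ <-]].
- by have := Rmax_r (a * x) 1; lra.
- by have := Rmax_l (1 * x) b; lra.
Qed.

Lemma pow_le1 (x : R) (n : nat) : 0 <= x <= 1 -> x ^ n <= 1.
Proof. by move=> x01; rewrite -(pow1 n); exact: pow_incr. Qed.

Lemma pow_gt1_exists (x b : R) : 1 < x -> exists n : nat, b < x ^ n.
Proof.
move=> x1; have [|n hn] := Pow_x_infinity x _ (b + 1).
  by rewrite Rabs_right; lra.
exists n; have := hn n (le_n n).
by rewrite Rabs_right; [lra | apply/Rle_ge/pow_le; lra].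
Qed.

Lemma pow_sub_le (s t : R) (n : nat) :
  0 < s <= t -> t ^ n - s ^ n <= INR n * (t ^ n / t) * (t - s).
Proof.
move=> st; elim: n => [|n IH]; first by rewrite /=; lra.
have tn : 0 <= INR n * (t ^ n / t) * (t - s).
  apply: Rmult_le_pos; last lra; apply: Rmult_le_pos; first exact: pos_INR.
  by apply: Rdiv_le_0_compat; [apply: pow_le|]; lra.
have := Rmult_le_compat_l s _ _ (Rlt_le _ _ (proj1 st)) IH.
have := Rmult_le_compat_r _ _ _ tn (proj2 st).
have -> : t * (INR n * (t ^ n / t) * (t - s)) = INR n * t ^ n * (t - s).
  by field; lra.
have -> : t ^ n.+1 / t = t ^ n by rewrite /=; field; lra.
by rewrite S_INR /=; lra.
Qed.

Lemma inv_pow_sub_le (s t : R) (n : nat) :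
  0 < s <= t -> / s ^ n - / t ^ n <= INR n * (/ s ^ n / s) * (t - s).
Proof.
move=> st; have sn : 0 < s ^ n by apply: pow_lt; lra.
have [ts0 ts] : 0 < / t <= / s.
  by split; [apply: Rinv_0_lt_compat | apply: Rinv_le_contravar]; lra.
have := pow_sub_le n (conj ts0 ts); rewrite !pow_inv => h; apply: Rle_trans h _.
have c0 : 0 <= INR n * / s ^ n.
  by apply: Rdiv_le_0_compat => //; exact: pos_INR.
have -> : INR n * (/ s ^ n / / s) * (/ s - / t) = INR n * / s ^ n * ((t - s) * / t).
  by field; lra.
have -> : INR n * (/ s ^ n / s) * (t - s) = INR n * / s ^ n * ((t - s) * / s).
  by field; lra.
by apply: Rmult_le_compat_l => //; apply: Rmult_le_compat_l; lra.
Qed.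

Lemma Rpower_inv_pow (A : R) (n : nat) :
  0 < A -> (0 < n)%N -> Rpower A (/ INR n) ^ n = A.
Proof.
move=> A0 n1; have nn := INR_ge1 n1.
rewrite -Rpower_pow; last exact: exp_pos.
by rewrite Rpower_mult Rinv_l ?Rpower_1; lra.
Qed.

Lemma Rpower_le1 (A z : R) : 0 < A <= 1 -> 0 <= z -> Rpower A z <= 1.
Proof.
move=> A01 z0; have := Rle_Rpower_l A 1 z z0 A01.
by rewrite [Rpower 1 z]/Rpower ln_1 Rmult_0_r exp_0.
Qed.

(* [x -> n exp (x / n)] is compared through the tangent line of [exp] at [0]. *)
Lemma mul_exp_div_le (x m n : R) : 0 < m -> 0 < n ->
  x * (/ m - / n) <= 1 - m / n -> m * exp (x / m) <= n * exp (x / n).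
Proof.
move=> m0 n0 h.
have mn : m / n <= exp (x / n - x / m).
  have := exp_ineq1_le (x / n - x / m); rewrite /Rdiv in h *; lra.
have -> : x / n = (x / n - x / m) + x / m by lra.
rewrite exp_plus -Rmult_assoc; apply: Rmult_le_compat_r; first exact/Rlt_le/exp_pos.
by rewrite Rmult_comm; apply/Rle_div_l.
Qed.

Lemma div_root_le (A : R) (n d : nat) : 0 < A <= 1 -> (0 < n <= d)%N ->
  INR n / Rpower A (/ INR n) <= Rmax (1 / A) (INR d / Rpower A (/ INR d)).
Proof.
move=> A01 /andP[n1 nd]; have hn := INR_ge1 n1; have hnd := le_nat_INR nd.
pose x := - ln A.
have rootE k : k / Rpower A (/ k) = k * exp (x / k).
  by rewrite /Rdiv -Rpower_Ropp /Rpower /x; congr (_ * exp _); ring.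
have -> : 1 / A = 1 * exp (x / 1).
  by rewrite /x Rdiv_1_r exp_Ropp exp_ln; lra.
have n_d : 0 <= / INR n - / INR d.
  by have := Rinv_le_contravar (INR n) (INR d); lra.
have n_n : INR n * / INR n = 1 by apply: Rinv_r; lra.
rewrite !rootE; case: (Rle_dec x (INR n)) => xn.
- apply: Rle_trans (Rmax_r _ _); apply: mul_exp_div_le; try lra.
  by have := Rmult_le_compat_r _ _ _ n_d xn; rewrite /Rdiv; lra.
- apply: Rle_trans (Rmax_l _ _); apply: mul_exp_div_le; try lra.
  have n_1 : 0 <= 1 - / INR n.
    by have := Rinv_le_contravar 1 (INR n); rewrite Rinv_1; lra.
  have := Rmult_le_compat_r _ _ _ n_1 (Rlt_le _ _ (Rnot_le_lt _ _ xn)).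
  by rewrite Rinv_1 Rdiv_1_r; lra.
Qed.

Lemma div_le_inv_root (A y t : R) (n : nat) : 0 < A -> 0 < t -> (0 < n)%N ->
  0 <= y <= 1 -> A * y <= t ^ n -> y / t <= / Rpower A (/ INR n).
Proof.
move=> A0 t0 n1 y01 Ay; have a0 : 0 < Rpower A (/ INR n) by exact: exp_pos.
have tn : 0 < t ^ n by exact: pow_lt.
rewrite -[/ _]Rmult_1_l; apply/(Rle_div_r _ _ _ a0).
apply: Rnot_lt_le => /(Rlt_pow_R1 _ n) /(_ (elimT leP n1)).
rewrite Rpow_mult_distr Rpower_inv_pow // Rpow_mult_distr pow_inv.
have -> : y ^ n * / t ^ n * A = y ^ n * A / t ^ n by field; lra.
move=> /Rlt_div_r; rewrite Rmult_1_l => /(_ tn).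
case: n n1 Ay {a0 tn} => // n _; rewrite -!tech_pow_Rmult => Ay.
have := pow_le1 n y01; have := pow_le y n (proj1 y01) => yn0 yn1.
have Ay0 : 0 <= A * y by apply: Rmult_le_pos; lra.
by have := Rmult_le_compat_l _ _ _ Ay0 yn1; lra.
Qed.

Lemma le_of_left_continuous (F : R -> R) (b c : R) : 0 < b -> continuity_pt F b ->
  (forall t, 0 < t < b -> F t <= c) -> F b <= c.
Proof.
move=> b0 cF le; apply: le_epsilon => eps e0; have [eta [eta0 near]] := cF eps e0.
pose t := b - Rmin (b / 2) (eta / 2).
have m0 : 0 < Rmin (b / 2) (eta / 2) by apply: Rmin_pos; lra.
have mb := Rmin_l (b / 2) (eta / 2); have me := Rmin_r (b / 2) (eta / 2).
have : Rabs (F t - F b) < eps.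
  apply: (near t); split; first by split=> //; rewrite /t; lra.
  by rewrite /= /Rdist Rabs_left1 /t; lra.
have : F t <= c by apply: le; rewrite /t; lra.
by move=> ? /Rabs_def2; lra.
Qed.

Definition is_inf (I : Type) (P : I -> Prop) (F : I -> R) (m : R) : Prop :=
  (forall i, P i -> m <= F i) /\
  (forall m', (forall i, P i -> m' <= F i) -> m' <= m).

Definition inf_on (I : Type) (P : I -> Prop) (F : I -> R) : R :=
  epsilon (inhabits 0) (is_inf P F).

Lemma is_inf_exists (I : Type) (P : I -> Prop) (F : I -> R) i :
  P i -> (forall i, 0 <= F i) -> exists m, is_inf P F m.
Proof.
move=> Pi F0; pose lower m := forall i, P i -> m <= F i.
have [m [ubm lubm]] : {m | is_lub lower m}.
  apply: completeness; last by exists 0 => j _; exact: F0.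
  by exists (F i) => m; apply.
exists m; split => [j Pj|m' lm']; last exact: ubm.
by apply: lubm => m'; apply.
Qed.

Lemma inf_onP (I : Type) (P : I -> Prop) (F : I -> R) i :
  P i -> (forall i, 0 <= F i) -> is_inf P F (inf_on P F).
Proof.
by move=> Pi F0; apply: (epsilon_spec (inhabits 0)); exact: is_inf_exists Pi F0.
Qed.

(** * Lipschitz bounds from finite closed covers *)

Lemma closed_set_le (F G : R -> R) : continuity F -> continuity G ->
  closed_set (fun t => F t <= G t).
Proof.
move=> cF cG t /Rnot_le_lt lt.
have [eta [eta0 near]] := continuity_minus _ _ cF cG t (F t - G t) ltac:(lra).
exists (mkposreal _ eta0) => s /= ts; apply: Rlt_not_le.
case: (Req_dec t s) => [<- //|nts].
have : Rabs (F s - G s - (F t - G t)) < F t - G t by apply: (near s).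
by move=> /Rabs_def2; lra.
Qed.

Lemma closed_set_forall (I : Type) (C : I -> R -> Prop) :
  (forall i, closed_set (C i)) -> closed_set (fun t => forall i, C i t).
Proof.
move=> clC t /existsNP[i nCi]; have [eta near] := clC i t nCi.
by exists eta => s /near nCs /(_ i).
Qed.

Lemma closed_set_and (C D : R -> Prop) :
  closed_set C -> closed_set D -> closed_set (fun t => C t /\ D t).
Proof.
move=> clC clD t /not_andP[/clC|/clD] [eta near];
  by exists eta => s /near ns [].
Qed.

Lemma neighbourhood_all_in (I : eqType) (V : I -> R -> Prop) (ks : seq I) (t : R) :
  (forall k, neighbourhood (V k) t) ->
  neighbourhood (fun s => forall k, k \in ks -> V k s) t.
Proof.
move=> nV; elim: ks => [|k ks [eta1 near1]]; first by exists (mkposreal _ Rlt_0_1).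
have [eta2 near2] := nV k.
exists (mkposreal _ (Rmin_pos _ _ (cond_pos eta1) (cond_pos eta2))) => s ts j.
rewrite inE => /orP[/eqP -> | jks].
- by apply/near2/(Rlt_le_trans _ _ _ ts); exact: Rmin_r.
- by apply: near1 jks; apply: Rlt_le_trans ts _; exact: Rmin_l.
Qed.

Lemma closed_cover_adherent (I : finType) (C : I -> R -> Prop) (S : R -> Prop) (m : R) :
  (forall k, closed_set (C k)) -> (forall t, S t -> exists k, C k t) ->
  point_adherent S m -> exists k t, [/\ C k m, C k t & S t].
Proof.
move=> clC cov adh; apply: contrapT => none.
have nV k : neighbourhood (fun t => ~ (C k t /\ S t)) m.
  case: (EM (C k m)) => [Ckm|/clC [eta near]]; last by exists eta => t /near nC [].
  exists (mkposreal _ Rlt_0_1) => t _ [Ckt St]; apply: none; by exists k, t.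
have [t [nCt St]] := adh _ (neighbourhood_all_in (index_enum I) nV).
have [k Ckt] := cov t St.
by apply: (nCt k); rewrite ?mem_index_enum.
Qed.

Lemma lub_lt_exists (S : R -> Prop) (m r : R) : is_lub S m -> r < m ->
  exists2 t, S t & r < t.
Proof.
move=> [_ lubm] rm; apply: contrapT => none; have : m <= r; last lra.
by apply: lubm => t St; apply: Rnot_lt_le => rt; apply: none; exists t.
Qed.

Lemma point_adherent_lub (S : R -> Prop) (m : R) : is_lub S m -> point_adherent S m.
Proof.
move=> lubm V [eta near]; have eta0 := cond_pos eta.
have [|t St lt] := lub_lt_exists (r := m - eta) lubm; first lra.
exists t; split=> //; apply: near; have tm := proj1 lubm t St.
by rewrite /disc Rabs_left1; lra.
Qed.

Lemma point_adherent_right (m b : R) : m < b -> point_adherent (fun t => m < t <= b) m.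
Proof.
move=> mb V [eta near]; have eta0 := cond_pos eta.
have r0 : 0 < Rmin (eta / 2) (b - m) by apply: Rmin_pos; lra.
have re := Rmin_l (eta / 2) (b - m); have rb := Rmin_r (eta / 2) (b - m).
exists (m + Rmin (eta / 2) (b - m)); split; last lra.
by apply: near; rewrite /disc Rabs_right; lra.
Qed.

(* The last point up to which the bound holds can be passed inside one of the sets. *)
Lemma lipschitz_of_closed_cover (I : finType) (C : I -> R -> Prop) (D : R -> R -> R)
    (L a b : R) :
  a <= b -> (forall k, closed_set (C k)) ->
  (forall t, a <= t <= b -> exists k, C k t) ->
  (forall s t, a <= s <= t -> t <= b -> D a t <= D a s + D s t) ->
  (forall k s t, a <= s <= t -> t <= b -> C k s -> C k t -> D s t <= L * (t - s)) ->
  D a b <= L * (b - a).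
Proof.
move=> ab clC cov tri lip.
pose S t := a <= t <= b /\ D a t <= L * (t - a).
have step k s t : S s -> s <= t <= b -> C k s -> C k t -> S t.
  move=> [sab Ds] [st tb] Cs Ct; have ast : a <= s <= t by lra.
  by have := tri s t ast tb; have := lip k s t ast tb Cs Ct; split; lra.
have Sa : S a.
  have [|k Ca] := cov a; first lra.
  by split; [lra | apply: (lip k); rewrite //; lra].
have [m lubm] : {m | is_lub S m}.
  by apply: completeness; [exists b => t [] | exists a]; tauto || lra.
have [ubm leastm] := lubm.
have am : a <= m by exact: ubm.
have mb : m <= b by apply: leastm => t [? _]; lra.
have Sm : S m.
  have [|k [t [Cm Ct St]]] := closed_cover_adherent clC _ (point_adherent_lub lubm).
    by move=> t [/cov].
  by apply: (step k t) => //; split=> //; exact: ubm.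
case: (Rle_lt_dec b m) => [bm|lt]; first by case: Sm => _; have -> : m = b by lra.
have [|k [t [Cm Ct mtb]]] := closed_cover_adherent clC _ (point_adherent_right lt).
  by move=> t mtb; apply: cov; lra.
have : t <= m by apply/ubm/(step k m) => //; lra.
by lra.
Qed.

(** * Limits along ultrafilters *)

Section UltrafilterLimit.
Local Open Scope classical_set_scope.
Variables (T : Type) (U : set_system T).
Hypothesis ultraU : UltraFilter U.
#[local] Instance properU : ProperFilter U := ultra_proper.
Implicit Types (F G : T -> R) (l m : R).

Lemma ultra_bounded_cvg F (b : R) : (forall c, 0 <= F c <= b) ->
  exists l : R, F @ U --> l.
Proof.
move=> Fb; have [|l [_ cl]] :=
  @segment_compact _ (0%ring : R) b (F @ U) (fmap_proper_filter F properU).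
  apply: (@filterE _ U) => c; rewrite /= in_itv /=.
  by apply/andP; split; apply/RleP; case: (Fb c).
exists l => N Nl; case: (in_ultra_setVsetC (F @^-1` N) ultraU) => // UN.
by have [c []] := cl (~` N) N UN Nl.
Qed.

Lemma ultra_cvg_unique F l m : F @ U --> l -> F @ U --> m -> l = m.
Proof.
have sepR : hausdorff_space R by exact: Rhausdorff.
exact: (@cvg_unique _ sepR (F @ U) (fmap_proper_filter F properU)).
Qed.

Lemma ultra_cvg_cst l : (fun _ : T => l) @ U --> l.
Proof. exact: cvg_cst. Qed.

Lemma ultra_cvgM F G l m : F @ U --> l -> G @ U --> m ->
  (fun c => F c * G c) @ U --> l * m.
Proof. exact: (@cvgM R). Qed.

Lemma ultra_cvg_le F G l m : F @ U --> l -> G @ U --> m ->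
  (forall c, F c <= G c) -> l <= m.
Proof.
move=> Fl Gm le; have GF : (fun c => G c - F c) @ U --> m - l by exact: (@cvgB R R^o).
have /RleP : (0 <= m - l)%ring; last by rewrite -R0E -RminusE; lra.
apply: (cvgr_to_ge GF); apply: (@filterE _ U) => c; apply/RleP; have := le c.
by rewrite -R0E; lra.
Qed.

Lemma ultra_cvg_max F G l m : F @ U --> l -> G @ U --> m ->
  (fun c => Rmax (F c) (G c)) @ U --> Rmax l m.
Proof.
have maxE (a b : R) : Rmax a b = ((a + b + `|a - b|) / 2%:R)%ring.
  by rewrite RmaxE; exact: maxr_absE.
move=> Fl Gm; rewrite maxE; under eq_fun do rewrite maxE.
apply: (@cvgM R); last exact: cvg_cst.
apply: (@cvgD R R^o); first exact: (@cvgD R R^o).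
by apply: (@cvg_norm R R^o); exact: (@cvgB R R^o).
Qed.

End UltrafilterLimit.

Bind Scope ring_scope with GRing.ClosedField.sort.

Section BerkovichLine.
Variables (K : closedFieldType) (abs : K -> R).
Hypothesis absP : nonarch_complete_abs abs.

Implicit Types (a b c u v w z : K) (f g h k p q : {poly K}) (x y : {poly K} -> R).
Implicit Types (l : K -> K -> R) (P Q J M : bpoint K) (r s t m : R).

(** * Nonarchimedean absolute values *)

Lemma abs_ge0 a : 0 <= abs a.
Proof. by case: absP. Qed.

Lemma abs_eq0 a : abs a = 0 <-> a = 0%ring.
Proof. by case: absP => _ []. Qed.

Lemma absM a b : abs (a * b) = abs a * abs b.
Proof. by case: absP => _ [_ [h _]]; exact: h. Qed.

Lemma absD a b : abs (a + b) <= Rmax (abs a) (abs b).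
Proof. by case: absP => _ [_ [_ [h _]]]; exact: h. Qed.

Lemma abs_nontrivial : exists a, abs a <> 0 /\ abs a <> 1.
Proof. by case: absP => _ [_ [_ [_ []]]]. Qed.

Lemma abs0 : abs 0 = 0.
Proof. exact/abs_eq0. Qed.

Lemma abs_gt0 a : a != 0%ring -> 0 < abs a.
Proof. by move=> /eqP a0; case: (abs_ge0 a) => // /esym/abs_eq0. Qed.

Lemma abs1 : abs 1 = 1.
Proof.
have sq : abs 1 = abs 1 * abs 1 by rewrite -absM mulr1.
have pos : 0 < abs 1 by apply: abs_gt0; exact: oner_neq0.
by apply: (Rmult_eq_reg_l (abs 1)); lra.
Qed.

Lemma absN a : abs (- a) = abs a.
Proof.
have absN1 : abs (-1) = 1.
  have sq : abs (-1) * abs (-1) = 1 by rewrite -absM mulrNN mulr1 abs1.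
  by have := abs_ge0 (-1) => ge0; nra.
by rewrite -mulN1r absM absN1 Rmult_1_l.
Qed.

Lemma absB a b : abs (a - b) <= Rmax (abs a) (abs b).
Proof. by rewrite -[abs b]absN; exact: absD. Qed.

Lemma absBC a b : abs (a - b) = abs (b - a).
Proof. by rewrite -absN opprB. Qed.

Lemma abs_sub_trans a b c : abs (a - c) <= Rmax (abs (a - b)) (abs (b - c)).
Proof. by rewrite -(subrKA b a (- c)); exact: absD. Qed.

Lemma absV a : a != 0%ring -> abs a^-1 = / abs a.
Proof.
move=> a0; have := abs_gt0 a0 => aa0; apply: (Rmult_eq_reg_r (abs a)); last lra.
by rewrite -absM mulVf // abs1 Rinv_l; lra.
Qed.

Lemma absX a n : abs (a ^+ n) = abs a ^ n.
Proof. by elim: n => [|n IH]; rewrite ?expr0 ?abs1 // exprS absM IH. Qed.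

Lemma absD_eq a b : abs b < abs a -> abs (a + b) = abs a.
Proof.
move=> lt; have := absD a b; rewrite Rmax_left; last lra.
have := absB (a + b) b; rewrite addrK.
by rmax_lra.
Qed.

Lemma abs_sum_mul_le (I : Type) (ks : seq I) (S : pred I) (F : I -> K) s m :
  0 <= m -> 0 <= s -> (forall i, S i -> abs (F i) * s <= m) ->
  abs (\sum_(i <- ks | S i) F i) * s <= m.
Proof.
move=> m0 s0 le; elim/big_rec: _ => [|i c Si cm]; first by rewrite abs0 Rmult_0_l.
apply: Rle_trans (Rmult_le_compat_r _ _ _ s0 (absD _ _)) _.
by rewrite Rmult_max_distr_r //; apply: Rmax_lub => //; exact: le.
Qed.

Lemma abs_sum_mul_lt (I : Type) (ks : seq I) (S : pred I) (F : I -> K) s m :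
  0 < m -> 0 <= s -> (forall i, S i -> abs (F i) * s < m) ->
  abs (\sum_(i <- ks | S i) F i) * s < m.
Proof.
move=> m0 s0 lt; elim/big_rec: _ => [|i c Si cm]; first by rewrite abs0 Rmult_0_l.
apply: Rle_lt_trans (Rmult_le_compat_r _ _ _ s0 (absD _ _)) _.
by rewrite Rmult_max_distr_r //; apply: Rmax_lub_lt => //; exact: lt.
Qed.

(** * Normalised ultrametric norms on linear forms *)

Definition unit_form u v : Prop := Rmax (abs u) (abs v) = 1.

Lemma unit_form10 : unit_form 1 0.
Proof. by rewrite /unit_form abs1 abs0; rmax_lra. Qed.

Lemma unit_form01 : unit_form 0 1.
Proof. by rewrite /unit_form abs1 abs0; rmax_lra. Qed.

Lemma unit_formC u v : unit_form u v -> unit_form v u.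
Proof. by rewrite /unit_form Rmax_comm. Qed.

Lemma unit_form_le1 u v : unit_form u v -> abs u <= 1 /\ abs v <= 1.
Proof. by move=> <-; split; [exact: Rmax_l | exact: Rmax_r]. Qed.

Lemma unit_form1N c : abs c <= 1 -> unit_form 1 (- c).
Proof. by rewrite /unit_form abs1 absN => c1; exact: Rmax_left. Qed.

Lemma unit_form_cases u v : unit_form u v -> abs u = 1 \/ abs v = 1.
Proof.
by rewrite /unit_form; case: (Rminmax.R.max_spec (abs u) (abs v)) => -[_ ->]; tauto.
Qed.

Lemma unit_form_shear b u v : abs b <= 1 -> unit_form u v -> unit_form u (u * b + v).
Proof.
move=> b1 uv; have ub : abs (u * b) <= abs u.
  by rewrite absM; have := Rmult_le_compat_l _ _ _ (abs_ge0 u) b1; lra.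
have le : abs (u * b + v) <= Rmax (abs (u * b)) (abs v) := absD _ _.
have ge : abs v <= Rmax (abs (u * b + v)) (abs (u * b)).
  by rewrite -{1}(addKr (u * b) v)%ring addrC; exact: absB.
by move: le ge; move: uv; rewrite /unit_form; rmax_lra.
Qed.

Lemma unit_form_scale u v : (u != 0%ring) || (v != 0%ring) ->
  exists c, [/\ c != 0%ring, abs c = Rmax (abs u) (abs v) & unit_form (u / c) (v / c)].
Proof.
move=> uv0; pose c := if Rle_dec (abs u) (abs v) then v else u.
have ac : abs c = Rmax (abs u) (abs v) by rewrite /c /Rmax; case: Rle_dec.
have c0 : c != 0%ring.
  apply/eqP => /abs_eq0; rewrite ac; case/orP: uv0 => /abs_gt0.
  - by have := Rmax_l (abs u) (abs v); lra.
  - by have := Rmax_r (abs u) (abs v); lra.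
exists c; split=> //; have ac0 := abs_gt0 c0.
by rewrite /unit_form !absM absV // -!/(Rdiv _ _) -Rmax_div // -ac Rdiv_diag; lra.
Qed.

Record form_norm l : Prop := FormNorm {
  form_norm_ge0 : forall u v, 0 <= l u v;
  form_normZ : forall c u v, l (c * u)%ring (c * v)%ring = abs c * l u v;
  form_normD : forall u v u' v', l (u + u')%ring (v + v')%ring <= Rmax (l u v) (l u' v');
  form_norm_max : Rmax (l 1%ring 0%ring) (l 0%ring 1%ring) = 1
}.

Definition swap l : K -> K -> R := fun u v => l v u.

Lemma form_norm_swap l : form_norm l -> form_norm (swap l).
Proof. by case=> ge0 Z D max; split; rewrite /swap // Rmax_comm. Qed.

Lemma form_norm10_le1 l : form_norm l -> l 1%ring 0%ring <= 1.
Proof. by move=> nl; rewrite -(form_norm_max nl); exact: Rmax_l. Qed.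

Lemma form_normN l u v : form_norm l -> l (- u)%ring (- v)%ring = l u v.
Proof. by move=> nl; rewrite -(mulN1r u) -(mulN1r v) form_normZ // absN abs1 Rmult_1_l. Qed.

Lemma form_norm_abs1 l c u v : form_norm l -> abs c = 1 -> l (c * u)%ring (c * v)%ring = l u v.
Proof. by move=> nl c1; rewrite form_normZ // c1 Rmult_1_l. Qed.

Lemma form_norm_det10 l u v u' v' : form_norm l ->
  abs (u * v' - u' * v) * l 1%ring 0%ring <= Rmax (abs v' * l u v) (abs v * l u' v').
Proof.
move=> nl; rewrite -!form_normZ // -(form_normN (v * u') _ nl) mulr0 mulr1.
have -> : (u * v' - u' * v = v' * u + - (v * u'))%ring by rewrite mulrC (mulrC u').
have -> : (0 = v' * v + - (v * v'))%ring by rewrite mulrC subrr.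
exact: form_normD.
Qed.

Lemma form_norm_det01 l u v u' v' : form_norm l ->
  abs (u * v' - u' * v) * l 0%ring 1%ring <= Rmax (abs u' * l u v) (abs u * l u' v').
Proof.
move=> nl; have := form_norm_det10 v u v' u' (form_norm_swap nl).
by rewrite /swap absBC (mulrC v') (mulrC v).
Qed.

Lemma abs_det_le l u v u' v' : form_norm l -> unit_form u v -> unit_form u' v' ->
  abs (u * v' - u' * v) <= Rmax (l u v) (l u' v').
Proof.
move=> nl /unit_form_le1[u1 v1] /unit_form_le1[u'1 v'1].
have bound c c' : abs c <= 1 -> abs c' <= 1 ->
    Rmax (abs c * l u v) (abs c' * l u' v') <= Rmax (l u v) (l u' v').
  move=> c1 c'1; rewrite -[X in _ <= Rmax X _]Rmult_1_l -[X in _ <= Rmax _ X]Rmult_1_l.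
  by apply: Rmax_le_compat; apply: Rmult_le_compat_r => //; exact: form_norm_ge0.
have := form_norm_det10 u v u' v' nl; have := form_norm_det01 u v u' v' nl.
have := bound _ _ v'1 v1; have := bound _ _ u'1 u1.
have := form_norm_max nl; case: (Rminmax.R.max_spec (l 1%ring 0%ring) (l 0%ring 1%ring)).
- by move=> [_ ->] ->; lra.
- by move=> [_ ->] ->; lra.
Qed.

Lemma form_norm_le_det_unitr l u v u' v' : form_norm l -> abs v <= 1 -> abs v' = 1 ->
  l u v <= Rmax (abs (u * v' - u' * v)) (l u' v').
Proof.
move=> nl v1 v'1; rewrite -(form_norm_abs1 u v nl v'1).
have -> : (v' * u = (u * v' - u' * v) * 1 + v * u')%ring.
  by rewrite mulr1 mulrC (mulrC v) subrK.
have -> : (v' * v = (u * v' - u' * v) * 0 + v * v')%ring by rewrite mulr0 add0r mulrC.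
apply: Rle_trans (form_normD nl _ _ _ _) _; rewrite !(form_normZ nl).
have l1 := form_norm10_le1 nl; have l'0 := form_norm_ge0 nl u' v'.
apply: Rmax_le_compat.
- by rewrite -[X in _ <= X]Rmult_1_r; exact: Rmult_le_compat_l (abs_ge0 _) l1.
- by rewrite -[X in _ <= X]Rmult_1_l; exact: Rmult_le_compat_r l'0 v1.
Qed.

Lemma form_norm_le_det l u v u' v' : form_norm l -> unit_form u v -> unit_form u' v' ->
  l u v <= Rmax (abs (u * v' - u' * v)) (l u' v').
Proof.
move=> nl /unit_form_le1[u1 v1] /unit_form_cases[u'1|v'1]; last exact: form_norm_le_det_unitr.
have := form_norm_le_det_unitr v v' (form_norm_swap nl) u1 u'1.
by rewrite /swap absBC (mulrC v') (mulrC v).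
Qed.

Lemma form_norm_ext l l' : form_norm l -> form_norm l' ->
  (forall u v, unit_form u v -> l u v = l' u v) -> l = l'.
Proof.
move=> nl nl' eq_unit; apply/funeq2P => u v.
case: (boolP ((u != 0%ring) || (v != 0%ring))) => [/unit_form_scale[c [c0 _ uv]]|].
  rewrite -[u](divfK c0) -[v](divfK c0) !(mulrC _ c) !form_normZ //.
  by rewrite eq_unit.
rewrite negb_or !negbK => /andP[/eqP -> /eqP ->].
have norm0 l1 : form_norm l1 -> l1 0%ring 0%ring = 0.
  by move=> n1; have := form_normZ n1 0 0 0; rewrite mulr0 abs0 Rmult_0_l.
by rewrite !norm0.
Qed.

(** * The joint infimum of two form norms *)

Definition join_diam l1 l2 : R :=
  inf_on (fun e : K * K => unit_form e.1 e.2) (fun e => Rmax (l1 e.1 e.2) (l2 e.1 e.2)).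

Definition diam l : R := join_diam l l.

Lemma join_diamP l1 l2 : form_norm l1 ->
  is_inf (fun e : K * K => unit_form e.1 e.2)
    (fun e => Rmax (l1 e.1 e.2) (l2 e.1 e.2)) (join_diam l1 l2).
Proof.
move=> n1; apply: (inf_onP (i := (1%ring, 0%ring))) => [|e]; first exact: unit_form10.
by apply: Rle_trans (Rmax_l _ _); exact: form_norm_ge0.
Qed.

Lemma join_diam_le l1 l2 u v : form_norm l1 -> unit_form u v ->
  join_diam l1 l2 <= Rmax (l1 u v) (l2 u v).
Proof. by move=> /(join_diamP l2)[le _] uv; exact: (le (u, v)). Qed.

Lemma join_diam_ge l1 l2 m : form_norm l1 ->
  (forall u v, unit_form u v -> m <= Rmax (l1 u v) (l2 u v)) -> m <= join_diam l1 l2.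
Proof. by move=> /(join_diamP l2)[_ ge] le; apply: ge => -[u v]; exact: le. Qed.

Lemma join_diam_ge0 l1 l2 : form_norm l1 -> 0 <= join_diam l1 l2.
Proof.
move=> n1; apply: join_diam_ge => // u v _.
by apply: Rle_trans (Rmax_l _ _); exact: form_norm_ge0.
Qed.

Lemma join_diam_lt l1 l2 t : form_norm l1 -> join_diam l1 l2 < t ->
  exists u v, [/\ unit_form u v, l1 u v < t & l2 u v < t].
Proof.
move=> n1 lt; apply: contrapT => none; have : t <= join_diam l1 l2; last lra.
apply: join_diam_ge => // u v uv; apply: Rnot_lt_le => /Rmax_Rlt[lt1 lt2].
by apply: none; exists u, v.
Qed.

Lemma join_diamC l1 l2 : join_diam l1 l2 = join_diam l2 l1.
Proof. by congr inf_on; apply/funext => e; exact: Rmax_comm. Qed.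

Lemma join_diam_le1 l1 l2 : form_norm l1 -> form_norm l2 -> join_diam l1 l2 <= 1.
Proof.
move=> n1 n2; apply: Rle_trans (join_diam_le _ n1 unit_form10) _.
by apply: Rmax_lub; exact: form_norm10_le1.
Qed.

Lemma diam_le l u v : form_norm l -> unit_form u v -> diam l <= l u v.
Proof.
by move=> nl uv; rewrite -(Rmax_left (l u v) (l u v)); [exact: join_diam_le | lra].
Qed.

Lemma diam_ge l m : form_norm l ->
  (forall u v, unit_form u v -> m <= l u v) -> m <= diam l.
Proof.
move=> nl le; apply: join_diam_ge => // u v uv.
by apply: Rle_trans (le _ _ uv) (Rmax_l _ _).
Qed.

Lemma diam_le_join_diam l1 l2 : form_norm l1 -> diam l1 <= join_diam l1 l2.
Proof.
move=> n1; apply: join_diam_ge => // u v uv.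
by apply: Rle_trans (diam_le n1 uv) (Rmax_l _ _).
Qed.

Lemma join_diam_swap l1 l2 : form_norm l1 ->
  join_diam (swap l1) (swap l2) = join_diam l1 l2.
Proof.
move=> n1; have ns := form_norm_swap n1; apply: Rle_antisym.
- by apply: join_diam_ge => // u v /unit_formC; exact: join_diam_le.
- by apply: join_diam_ge => // u v /unit_formC; exact: join_diam_le.
Qed.

Lemma diam_swap l : form_norm l -> diam (swap l) = diam l.
Proof. exact: join_diam_swap. Qed.

Lemma join_diam_ultrametric l1 l2 l3 :
  form_norm l1 -> form_norm l2 -> form_norm l3 ->
  join_diam l1 l3 <= Rmax (join_diam l1 l2) (join_diam l2 l3).
Proof.
move=> n1 n2 n3; apply: Rnot_lt_le => /Rmax_Rlt[lt12 lt23].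
have [u [v [uv u1 u2]]] := join_diam_lt n1 lt12.
have [u' [v' [uv' u2' u3']]] := join_diam_lt n2 lt23.
have := abs_det_le n2 uv' uv; have := form_norm_le_det n1 uv' uv.
by have := join_diam_le l3 n1 uv'; rmax_lra.
Qed.

Lemma form_norm_eq_of_diam_le l l' : form_norm l -> form_norm l' ->
  (forall u v, unit_form u v -> l u v <= l' u v) -> diam l' <= diam l -> l = l'.
Proof.
move=> nl nl' le le_diam; apply: form_norm_ext => // u v uv.
apply: Rle_antisym; first exact: le.
apply: Rnot_lt_le => lt; have lt' : diam l' < l' u v by have := diam_le nl uv; lra.
have [u' [v' [uv' lt1 _]]] := join_diam_lt nl' lt'.
have := form_norm_le_det nl' uv uv'; have := abs_det_le nl uv uv'; have := le _ _ uv'.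
by rmax_lra.
Qed.

Definition form_dist l1 l2 : R := 2 * join_diam l1 l2 - diam l1 - diam l2.

Lemma form_distC l1 l2 : form_dist l1 l2 = form_dist l2 l1.
Proof. by rewrite /form_dist join_diamC; lra. Qed.

Lemma form_distxx l : form_dist l l = 0.
Proof. by rewrite /form_dist /diam; lra. Qed.

Lemma form_dist_ge0 l1 l2 : form_norm l1 -> form_norm l2 -> 0 <= form_dist l1 l2.
Proof.
move=> n1 n2; rewrite /form_dist.
have := diam_le_join_diam l2 n1; have := diam_le_join_diam l1 n2.
by rewrite (join_diamC l2); lra.
Qed.

Lemma form_dist_triangle l1 l2 l3 : form_norm l1 -> form_norm l2 -> form_norm l3 ->
  form_dist l1 l3 <= form_dist l1 l2 + form_dist l2 l3.
Proof.
move=> n1 n2 n3; rewrite /form_dist; have := join_diam_ultrametric n1 n2 n3.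
have := diam_le_join_diam l1 n2; have := diam_le_join_diam l3 n2.
by rewrite (join_diamC l2 l1); rmax_lra.
Qed.

Lemma form_dist_swap l1 l2 : form_norm l1 -> form_norm l2 ->
  form_dist (swap l1) (swap l2) = form_dist l1 l2.
Proof.
by move=> n1 n2; rewrite /form_dist (join_diam_swap l2 n1) (diam_swap n1) (diam_swap n2).
Qed.

(** * Multiplicative seminorms on [K[T]] *)

Local Notation lin c := ('X - c%:P)%ring.

Section Seminorm.
Variable x : {poly K} -> R.
Hypothesis xP : is_seminorm abs x.

Lemma seminorm_ge0 h : 0 <= x h.
Proof. by case: xP. Qed.

Lemma seminormM h k : x (h * k)%ring = x h * x k.
Proof. by case: xP => _ [e _]; exact: e. Qed.

Lemma seminormD h k : x (h + k)%ring <= Rmax (x h) (x k).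
Proof. by case: xP => _ [_ [e _]]; exact: e. Qed.

Lemma seminormC c : x (c%:P)%ring = abs c.
Proof. by case: xP => _ [_ [_ e]]; exact: e. Qed.

Lemma seminorm0 : x 0%ring = 0.
Proof. by rewrite -polyC0 seminormC abs0. Qed.

Lemma seminorm1 : x 1%ring = 1.
Proof. by rewrite -polyC1 seminormC abs1. Qed.

Lemma seminormZ c h : x (c *: h)%ring = abs c * x h.
Proof. by rewrite -mul_polyC seminormM seminormC. Qed.

Lemma seminormN h : x (- h)%ring = x h.
Proof. by rewrite -scaleN1r seminormZ absN abs1 Rmult_1_l. Qed.

Lemma seminormB h k : x (h - k)%ring <= Rmax (x h) (x k).
Proof. by rewrite -[x k]seminormN; exact: seminormD. Qed.

Lemma seminormX h n : x (h ^+ n)%ring = x h ^ n.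
Proof. by elim: n => [|n IH]; rewrite ?expr0 ?seminorm1 // exprS seminormM IH. Qed.

Lemma seminorm_le_addl h k : x h <= Rmax (x (h + k)%ring) (x k).
Proof. by rewrite -{1}(addrK k h); exact: seminormB. Qed.

Lemma seminormD_eq h k : x k < x h -> x (h + k)%ring = x h.
Proof.
by move=> lt; have := seminormD h k; have := seminorm_le_addl h k; rmax_lra.
Qed.

Lemma seminorm_prod (I : Type) (ks : seq I) (F : I -> {poly K}) :
  x (\prod_(i <- ks) F i)%ring = \big[Rmult/1]_(i <- ks) x (F i).
Proof.
by elim: ks => [|i ks IH]; rewrite ?big_nil ?seminorm1 // !big_cons seminormM IH.
Qed.

Lemma seminorm_lin_le a b : x (lin a) <= Rmax (x (lin b)) (abs (a - b)).
Proof.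
have -> : lin a = (lin b - (a - b)%:P)%ring by rewrite polyCB opprB addrA subrK.
by rewrite -[abs _]seminormC; exact: seminormB.
Qed.

Lemma abs_sub_le_lin a b : abs (a - b) <= Rmax (x (lin a)) (x (lin b)).
Proof.
rewrite Rmax_comm -[abs _]seminormC.
have -> : ((a - b)%:P)%ring = (lin b - lin a)%ring by rewrite polyCB opprB [RHS]addrC subrKA.
exact: seminormB.
Qed.

Lemma seminorm_lin_leX a : x (lin a) <= Rmax (x 'X%ring) (abs a).
Proof. by have := seminorm_lin_le a 0; rewrite !subr0. Qed.

Lemma seminormX_le_lin a : x 'X%ring <= Rmax (x (lin a)) (abs a).
Proof. by have := seminorm_lin_le 0 a; rewrite subr0 sub0r absN. Qed.

Lemma abs_le_lin a : abs a <= Rmax (x (lin a)) (x 'X%ring).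
Proof. by have := abs_sub_le_lin a 0; rewrite !subr0. Qed.

End Seminorm.

Lemma seminorm_eval c : is_seminorm abs (fun h => abs h.[c]).
Proof.
split; first by move=> h; exact: abs_ge0.
split; first by move=> h k; rewrite /Pmul hornerM absM.
split; first by move=> h k; rewrite /Padd hornerD; exact: absD.
by move=> a; rewrite /Pconst hornerC.
Qed.

Lemma seminorm_comp x q : is_seminorm abs x ->
  is_seminorm abs (fun h => x (h \Po q)%ring).
Proof.
move=> xP; split; first by move=> h; exact: seminorm_ge0.
split; first by move=> h k; rewrite /Pmul comp_polyM seminormM.
split; first by move=> h k; rewrite /Padd comp_polyD; exact: seminormD.
by move=> c; rewrite /Pconst comp_polyC seminormC.
Qed.

Lemma big_Rmult_le (I : Type) (ks : seq I) (F G : I -> R) :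
  (forall i, 0 <= F i <= G i) ->
  0 <= \big[Rmult/1]_(i <- ks) F i <= \big[Rmult/1]_(i <- ks) G i.
Proof.
move=> FG; elim: ks => [|i ks IH]; rewrite ?big_nil ?big_cons; first lra.
have := FG i; split; first by apply: Rmult_le_pos; lra.
by apply: Rmult_le_compat; lra.
Qed.

Lemma seminorm_roots h : exists zs : seq K, forall x, is_seminorm abs x ->
  x h = abs (lead_coef h) * \big[Rmult/1]_(z <- zs) x (lin z).
Proof.
have [zs hE] := closed_field_poly_normal h; exists zs => x xP.
by rewrite {1}hE seminormZ // seminorm_prod.
Qed.

Lemma seminorm_le_of_lin x y : is_seminorm abs x -> is_seminorm abs y ->
  (forall c, x (lin c) <= y (lin c)) -> forall h, x h <= y h.
Proof.
move=> xP yP le h; have [zs hE] := seminorm_roots h; rewrite !hE //.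
apply: Rmult_le_compat_l; first exact: abs_ge0.
have xy z : 0 <= x (lin z) <= y (lin z) by split; [exact: seminorm_ge0 | exact: le].
exact: (proj2 (big_Rmult_le zs xy)).
Qed.

Lemma seminorm_ext_lin x y : is_seminorm abs x -> is_seminorm abs y ->
  (forall c, x (lin c) = y (lin c)) -> x = y.
Proof.
move=> xP yP e; apply/funext => h.
by apply: Rle_antisym; apply: seminorm_le_of_lin => // c; rewrite e; lra.
Qed.

Lemma radiusP x : is_seminorm abs x ->
  is_inf (fun _ : K => True) (fun c => x (lin c)) (radius x).
Proof.
move=> xP; have lin0 c : 0 <= x (lin c) by exact: seminorm_ge0.
have [m [lem gem]] := is_inf_exists (i := 0%ring) (P := xpredpT) I lin0.
have [le ge] : (forall c, radius x <= x (Plin c)) /\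
    (forall m', (forall c, m' <= x (Plin c)) -> m' <= radius x).
  apply: (epsilon_spec (inhabits 0) (fun m => (forall c, m <= x (Plin c)) /\
    (forall m', (forall c, m' <= x (Plin c)) -> m' <= m))).
  by exists m; split=> [c|m' le]; [exact: lem | apply: gem => c _; exact: le].
by split=> [c _|m' le']; [exact: le | apply: ge => c; exact: le'].
Qed.

Lemma radius_le x c : is_seminorm abs x -> radius x <= x (lin c).
Proof. by move=> /radiusP[le _]; exact: le. Qed.

Lemma radius_ge x m : is_seminorm abs x -> (forall c, m <= x (lin c)) -> m <= radius x.
Proof. by move=> /radiusP[_ ge] le; apply: ge => c _; exact: le. Qed.

Lemma radius_ge0 x : is_seminorm abs x -> 0 <= radius x.
Proof. by move=> xP; apply: radius_ge => // c; exact: seminorm_ge0. Qed.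

Lemma radius_lt x t : is_seminorm abs x -> radius x < t -> exists c, x (lin c) < t.
Proof.
move=> xP lt; apply: contrapT => none; have : t <= radius x; last lra.
by apply: radius_ge => // c; apply: Rnot_lt_le => ltc; apply: none; exists c.
Qed.

(** * Gauss norms *)

Definition monomial_norm h t (i : nat) : R := abs h`_i * t ^ i.

Definition gauss t h : R := \big[Rmax/0]_(i < size h) monomial_norm h t i.

Definition gauss_at a t h : R := gauss t (h \Po ('X + a%:P))%ring.

Lemma monomial_norm_ge0 h t i : 0 <= t -> 0 <= monomial_norm h t i.
Proof. by move=> t0; apply: Rmult_le_pos; [exact: abs_ge0 | exact: pow_le]. Qed.

Lemma monomial_norm_default h t i : (size h <= i)%N -> monomial_norm h t i = 0.
Proof. by move=> hi; rewrite /monomial_norm nth_default // abs0 Rmult_0_l. Qed.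

Lemma monomial_norm1 h i : monomial_norm h 1 i = abs h`_i.
Proof. by rewrite /monomial_norm pow1 Rmult_1_r. Qed.

Lemma monomial_normM c c' t i j :
  abs (c * c') * t ^ (i + j)%N = abs c * t ^ i * (abs c' * t ^ j).
Proof. by rewrite absM -[(i + j)%N]/(i + j)%coq_nat pow_add; ring. Qed.

Lemma big_Rmax_ge0 (I : Type) (ks : seq I) (F : I -> R) :
  0 <= \big[Rmax/0]_(i <- ks) F i.
Proof.
by elim/big_rec: _ => [|i r _ r0]; [lra | apply: Rle_trans r0 (Rmax_r _ _)].
Qed.

Lemma big_Rmax_ge (I : eqType) (ks : seq I) (F : I -> R) i :
  i \in ks -> F i <= \big[Rmax/0]_(i <- ks) F i.
Proof.
elim: ks => // j ks IH; rewrite inE big_cons => /orP[/eqP ->|/IH le].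
  exact: Rmax_l.
exact: Rle_trans le (Rmax_r _ _).
Qed.

Lemma big_Rmax_attained (n : nat) (F : nat -> R) : (forall i, 0 <= F i) ->
  exists2 i, (i <= n)%N & \big[Rmax/0]_(i < n.+1) F i = F i.
Proof.
elim: n F => [|n IH] F F0.
  by exists 0%N => //; rewrite big_ord_recl big_ord0 Rmax_left.
rewrite big_ord_recl; have [i i_n ->] := IH (F \o S) (fun i => F0 i.+1).
by rewrite /Rmax; case: Rle_dec => _; [exists i.+1 | exists 0%N].
Qed.

Lemma gauss_ge0 t h : 0 <= gauss t h.
Proof. exact: big_Rmax_ge0. Qed.

Lemma gauss_ge t h i : monomial_norm h t i <= gauss t h.
Proof.
case: (ltnP i (size h)) => hi; last by rewrite monomial_norm_default //; exact: gauss_ge0.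
apply: (big_Rmax_ge (fun i : 'I_(size h) => monomial_norm h t i) (i := Ordinal hi)).
by rewrite mem_index_enum.
Qed.

Lemma gauss_leP t h m :
  gauss t h <= m <-> 0 <= m /\ forall i, monomial_norm h t i <= m.
Proof.
split=> [le|[m0 le]].
  split=> [|i]; first exact: Rle_trans (gauss_ge0 t h) le.
  exact: Rle_trans (gauss_ge t h i) le.
by apply: (big_ind (fun r => r <= m)) => // *; exact: Rmax_lub.
Qed.

Lemma gauss_attained t h d : 0 <= t -> (size h <= d.+1)%N ->
  exists2 i, (i <= d)%N & gauss t h = monomial_norm h t i.
Proof.
rewrite /gauss; case sh : (size h) => [|n] t0 nd.
  by exists 0%N => //; rewrite big_ord0 monomial_norm_default ?sh.
have [i i_n ->] := big_Rmax_attained n (fun i => monomial_norm_ge0 h i t0).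
by exists i => //; exact: leq_trans i_n nd.
Qed.

Lemma gaussD t h k : 0 <= t -> gauss t (h + k)%ring <= Rmax (gauss t h) (gauss t k).
Proof.
move=> t0; apply/gauss_leP; split=> [|i].
  by apply: Rle_trans (Rmax_l _ _); exact: gauss_ge0.
apply: Rle_trans (Rmax_le_compat _ _ _ _ (gauss_ge t h i) (gauss_ge t k i)).
rewrite /monomial_norm coefD -Rmult_max_distr_r; last exact: pow_le.
by apply: Rmult_le_compat_r; [exact: pow_le | exact: absD].
Qed.

Lemma gaussC t c : gauss t c%:P%ring = abs c.
Proof.
apply: Rle_antisym; last first.
  by have := gauss_ge t c%:P%ring 0; rewrite /monomial_norm coefC Rmult_1_r.
apply/gauss_leP; split=> [|[|i]]; first exact: abs_ge0.
- by rewrite /monomial_norm coefC /= Rmult_1_r; exact: Rle_refl.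
- by rewrite /monomial_norm coefC abs0 Rmult_0_l; exact: abs_ge0.
Qed.

Lemma gaussM_le t h k : 0 <= t -> gauss t (h * k)%ring <= gauss t h * gauss t k.
Proof.
move=> t0; have hk0 : 0 <= gauss t h * gauss t k by apply: Rmult_le_pos; exact: gauss_ge0.
apply/gauss_leP; split=> // n; rewrite /monomial_norm coefM.
apply: abs_sum_mul_le => [//||[j jn] _ /=]; first exact: pow_le.
rewrite -{2}(subnKC (jn : (j <= n)%N)) monomial_normM.
by apply: Rmult_le_compat; [exact: monomial_norm_ge0 | exact: monomial_norm_ge0
  | exact: gauss_ge | exact: gauss_ge].
Qed.

Lemma gauss_first t h : 0 <= t -> exists i, gauss t h = monomial_norm h t i /\
  forall j, (j < i)%N -> monomial_norm h t j < gauss t h.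
Proof.
move=> t0; have ex : exists i, `[< gauss t h = monomial_norm h t i >].
  by have [i _ e] := gauss_attained t0 (leqSpred (size h)); exists i; exact/asboolP.
case: (ex_minnP ex) => i /asboolP e least; exists i; split=> // j ji.
case: (gauss_ge t h j) => // ej.
by have := least j (asboolT (esym ej)); rewrite leqNgt ji.
Qed.

(* The product of the first dominant monomials of [h] and [k] dominates [h * k]. *)
Lemma gaussM_ge t h k : 0 <= t -> gauss t h * gauss t k <= gauss t (h * k)%ring.
Proof.
move=> t0; have := gauss_ge0 t h; have := gauss_ge0 t k.
move=> [k0|<-]; last by rewrite Rmult_0_r => _; exact: gauss_ge0.
move=> [h0|<-]; last by rewrite Rmult_0_l; exact: gauss_ge0.
have [i [hi first_i]] := gauss_first h t0; have [j [kj first_j]] := gauss_first k t0.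
have hk0 : 0 < gauss t h * gauss t k by apply: Rmult_lt_0_compat.
apply: Rle_trans (gauss_ge _ _ (i + j)%N); rewrite /monomial_norm coefM.
have i_ij : (i < (i + j).+1)%N by rewrite ltnS leq_addr.
have dominant : gauss t h * gauss t k = abs (h`_i * k`_j) * t ^ (i + j)%N.
  by rewrite monomial_normM hi kj.
have tij : 0 < t ^ (i + j)%N.
  by case: (pow_le _ (i + j)%N t0) => // tij; move: hk0; rewrite dominant -tij; lra.
rewrite (bigD1 (Ordinal i_ij)) //= addKn absD_eq -?dominant; first exact: Rle_refl.
apply: (Rmult_lt_reg_r (t ^ (i + j)%N)) => //; rewrite -dominant.
apply: abs_sum_mul_lt => [|| -[l l_ij]]; [done | exact: Rlt_le|]; rewrite -val_eqE /= => li.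
rewrite -{2}(subnKC (l_ij : (l <= i + j)%N)) monomial_normM.
have := gauss_ge t h l; have := gauss_ge t k (i + j - l).
have := monomial_norm_ge0 h l t0; have := monomial_norm_ge0 k (i + j - l) t0.
rewrite -!/(monomial_norm _ _ _); move: li; rewrite neq_ltn => /orP[/first_i|il].
  by move=> *; nra.
have /first_j : (i + j - l < j)%N by rewrite ltn_subLR // ltn_add2r.
by move=> *; nra.
Qed.

Lemma gaussM t h k : 0 <= t -> gauss t (h * k)%ring = gauss t h * gauss t k.
Proof. by move=> t0; apply: Rle_antisym; [exact: gaussM_le | exact: gaussM_ge]. Qed.

Lemma seminorm_gauss t : 0 <= t -> is_seminorm abs (gauss t).
Proof.
move=> t0; split; first by move=> h; exact: gauss_ge0.
split; first by move=> h k; exact: gaussM.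
by split; [move=> h k; exact: gaussD | exact: gaussC].
Qed.

Lemma seminorm_gauss_at a t : 0 <= t -> is_seminorm abs (gauss_at a t).
Proof. by move=> t0; exact/seminorm_comp/seminorm_gauss. Qed.

Lemma gauss_lform t u v : 0 <= t ->
  gauss t (u *: 'X + v%:P)%ring = Rmax (abs u * t) (abs v).
Proof.
move=> t0; have coef i : ((u *: 'X + v%:P)`_i)%ring = nth 0%ring [:: v; u] i.
  by rewrite coefD coefZ coefX coefC; case: i => [|[|i]] /=;
    rewrite ?nth_nil ?mulr0 ?mulr1 ?addr0 ?add0r.
have norm0 : monomial_norm (u *: 'X + v%:P)%ring t 0 = abs v.
  by rewrite /monomial_norm coef Rmult_1_r.
have norm1 : monomial_norm (u *: 'X + v%:P)%ring t 1 = abs u * t.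
  by rewrite /monomial_norm coef /= Rmult_1_r.
apply: Rle_antisym; last first.
  by apply: Rmax_lub; rewrite -?norm0 -?norm1; exact: gauss_ge.
have ge0 : 0 <= Rmax (abs u * t) (abs v).
  by apply: Rle_trans (abs_ge0 v) (Rmax_r _ _).
apply/gauss_leP; split=> // -[|[|i]]; rewrite ?norm0 ?norm1.
- exact: Rmax_r.
- exact: Rmax_l.
- by rewrite /monomial_norm coef /= nth_nil abs0 Rmult_0_l.
Qed.

Lemma gauss_at_lform a t u v : 0 <= t ->
  gauss_at a t (u *: 'X + v%:P)%ring = Rmax (abs u * t) (abs (u * a + v)).
Proof.
move=> t0; rewrite /gauss_at -gauss_lform //; congr gauss.
by rewrite comp_polyD comp_polyZ comp_polyX comp_polyC scalerDr polyCD polyCM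
  mul_polyC addrA.
Qed.

Lemma gauss_at_lin a t c : 0 <= t -> gauss_at a t (lin c) = Rmax t (abs (a - c)).
Proof.
move=> t0; have := gauss_at_lform a 1 (- c) t0.
by rewrite scale1r polyCN mul1r abs1 Rmult_1_l.
Qed.

Lemma gauss_atX a t : 0 <= t -> gauss_at a t 'X%ring = Rmax t (abs a).
Proof. by move=> t0; have := gauss_at_lin a 0 t0; rewrite !subr0. Qed.

Lemma seminorm_le_gauss_at x a t : is_seminorm abs x -> x (lin a) <= t ->
  forall h, x h <= gauss_at a t h.
Proof.
move=> xP xa; have t0 : 0 <= t by apply: Rle_trans xa; exact: seminorm_ge0.
apply: seminorm_le_of_lin => // [|c]; first exact: seminorm_gauss_at.
rewrite gauss_at_lin // absBC; apply: Rle_trans (seminorm_lin_le xP c a) _.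
by apply: Rmax_le_compat => //; exact: Rle_refl.
Qed.

Lemma gauss_at_center x a b t : is_seminorm abs x ->
  x (lin a) <= t -> x (lin b) <= t -> gauss_at a t = gauss_at b t.
Proof.
move=> xP xa xb; have t0 : 0 <= t by apply: Rle_trans xa; exact: seminorm_ge0.
apply: seminorm_ext_lin; try exact: seminorm_gauss_at.
move=> c; rewrite !gauss_at_lin //; have := abs_sub_le_lin xP a b.
have := abs_sub_trans a b c; have := abs_sub_trans b a c; have := absBC a b.
by rmax_lra.
Qed.

Lemma seminorm_eq_gauss_at x b t : is_seminorm abs x -> x (lin b) <= t ->
  t <= radius x -> x = gauss_at b t.
Proof.
move=> xP xb tx; have t0 : 0 <= t by apply: Rle_trans xb; exact: seminorm_ge0.
apply: seminorm_ext_lin => // [|c]; first exact: seminorm_gauss_at.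
rewrite gauss_at_lin //; have := radius_le c xP; have := seminorm_lin_le xP c b.
have := abs_sub_le_lin xP b c; have := absBC b c.
by rmax_lra.
Qed.

Lemma gauss_at0 t : gauss_at 0 t = gauss t.
Proof. by apply/funext => h; rewrite /gauss_at polyC0 addr0 comp_polyXr. Qed.

Lemma gauss_normE : gauss_norm abs = gauss 1.
Proof.
apply/funext => h.
rewrite /gauss_norm foldrE big_map (big_nth 0%ring) big_mkord.
by apply: eq_bigr => i _; rewrite monomial_norm1.
Qed.

Lemma seminorm_gauss_norm : is_seminorm abs (gauss_norm abs).
Proof. by rewrite gauss_normE; apply: seminorm_gauss; lra. Qed.

Lemma gauss_zero_free h r : 0 <= r -> (forall z, root h z -> r <= abs z) ->
  gauss r h = abs h`_0.
Proof.
move=> r0 zero_free; have [zs hE] := closed_field_poly_normal h.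
have gr := seminorm_gauss r0; have ev := seminorm_eval 0.
rewrite -horner_coef0 -[abs h.[0]]/((fun h => abs h.[0]) h) {1 2}hE.
rewrite !(seminormZ gr, seminormZ ev, seminorm_prod gr, seminorm_prod ev).
congr (_ * _); apply: eq_big_seq => z zs_z.
rewrite -gauss_at0 gauss_at_lin // hornerXsubC Rmax_right // sub0r absN.
by apply: zero_free; rewrite hE rootE hornerZ (eqP (_ : root _ z)) ?mulr0 // root_prod_XsubC.
Qed.

(** * Points of the projective line as norms on linear forms *)

Definition pencil f g u v : {poly K} := (u *: f + v *: g)%ring.

Definition pencil_norm x f g : K -> K -> R :=
  fun u v => x (pencil f g u v) / Rmax (x f) (x g).

Lemma pencil10 f g : pencil f g 1 0 = f.
Proof. by rewrite /pencil scale1r scale0r addr0. Qed.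

Lemma pencil01 f g : pencil f g 0 1 = g.
Proof. by rewrite /pencil scale1r scale0r add0r. Qed.

Lemma pencilC f g u v : pencil g f v u = pencil f g u v.
Proof. exact: addrC. Qed.

Lemma pencilD f g u v u' v' :
  pencil f g (u + u') (v + v') = (pencil f g u v + pencil f g u' v')%ring.
Proof. by rewrite /pencil !scalerDl addrACA. Qed.

Lemma pencilZ f g c u v : pencil f g (c * u) (c * v) = (c *: pencil f g u v)%ring.
Proof. by rewrite /pencil scalerDr !scalerA. Qed.

Lemma pencil_coef f g u v i : ((pencil f g u v)`_i = u * f`_i + v * g`_i)%ring.
Proof. by rewrite coefD !coefZ. Qed.

Lemma pencil_comp f g q u v :
  (pencil f g u v \Po q)%ring = pencil (f \Po q) (g \Po q) u v.
Proof. by rewrite comp_polyD !comp_polyZ. Qed.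

Lemma size_pencil f g u v d : (size f <= d)%N -> (size g <= d)%N ->
  (size (pencil f g u v) <= d)%N.
Proof.
move=> fd gd; apply: leq_trans (size_polyD _ _) _; rewrite geq_max.
by rewrite !(leq_trans (size_scale_leq _ _)).
Qed.

Lemma pencil_lform u v : pencil 'X 1 u v = (u *: 'X + v%:P)%ring.
Proof. by rewrite /pencil -mul_polyC -alg_polyC -!mul_polyC mulr1. Qed.

Lemma form_norm_pencil x f g : is_seminorm abs x -> 0 < Rmax (x f) (x g) ->
  form_norm (pencil_norm x f g).
Proof.
move=> xP m0; rewrite /pencil_norm; split=> [u v|c u v|u v u' v'|].
- by apply: Rdiv_le_0_compat => //; exact: seminorm_ge0.
- by rewrite pencilZ seminormZ // /Rdiv Rmult_assoc.
- rewrite pencilD -Rmax_div //; apply: Rmult_le_compat_r; last exact: seminormD.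
  exact/Rlt_le/Rinv_0_lt_compat.
- by rewrite pencil10 pencil01 -Rmax_div // Rdiv_diag; lra.
Qed.

Lemma pencil_norm_swap x f g : pencil_norm x g f = swap (pencil_norm x f g).
Proof. by apply/funeq2P => u v; rewrite /pencil_norm /swap pencilC Rmax_comm. Qed.

Definition ell P : K -> K -> R :=
  if P is Some x then pencil_norm x 'X%ring 1%ring else fun u _ => abs u.

Definition height x : R := Rmax 1 (x 'X%ring).

Lemma height_ge1 x : 1 <= height x.
Proof. exact: Rmax_l. Qed.

Lemma le_height x : x 'X%ring <= height x.
Proof. exact: Rmax_r. Qed.

Lemma height_gt0 x : 0 < height x.
Proof. by have := height_ge1 x; lra. Qed.

Lemma radius_le_height x : is_seminorm abs x -> radius x <= height x.
Proof.
by move=> xP; apply: Rle_trans (le_height x); have := radius_le 0 xP; rewrite subr0.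
Qed.

Lemma ell_lform x u v : is_seminorm abs x ->
  ell (Some x) u v = x (u *: 'X + v%:P)%ring / height x.
Proof. by move=> xP; rewrite /= /pencil_norm pencil_lform seminorm1 // Rmax_comm. Qed.

Lemma seminorm_lform x u v : is_seminorm abs x -> u != 0%ring ->
  x (u *: 'X + v%:P)%ring = abs u * x (lin (- (v / u))).
Proof.
move=> xP u0; rewrite -seminormZ // scalerBr -[(u *: _%:P)%ring]mul_polyC -polyCM.
by rewrite mulrN mulrC divfK // polyCN opprK.
Qed.

Lemma lform0 v : (0 *: 'X + v%:P)%ring = v%:P%ring :> {poly K}.
Proof. by rewrite scale0r add0r. Qed.

Lemma ell_lin x c : is_seminorm abs x -> ell (Some x) 1%ring (- c)%ring = x (lin c) / height x.
Proof. by move=> xP; rewrite ell_lform // scale1r polyCN. Qed.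

Lemma ell01 x : is_seminorm abs x -> ell (Some x) 0%ring 1%ring = / height x.
Proof. by move=> xP; rewrite ell_lform // lform0 seminormC // abs1 Rdiv_1_l. Qed.

Lemma ell_norm P : is_berk abs P -> form_norm (ell P).
Proof.
case: P => [x|] /= xP.
  apply: form_norm_pencil => //; rewrite seminorm1 //.
  exact: Rlt_le_trans Rlt_0_1 (Rmax_r _ _).
split=> [u v|c u v|u v u' v'|]; [exact: abs_ge0 | exact: absM | exact: absD |].
by rewrite abs0 abs1 Rmax_left; lra.
Qed.

Lemma ell_inj P Q : is_berk abs P -> is_berk abs Q -> ell P = ell Q -> P = Q.
Proof.
have not_infty x : is_seminorm abs x -> ell (Some x) <> ell None.
  move=> xP /(congr1 (fun l => l 0%ring 1%ring)); rewrite ell01 //= abs0.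
  by have := Rinv_0_lt_compat _ (height_gt0 x); lra.
case: P Q => [x|] [y|] // xP yP e; last 2 first.
- by case: (not_infty x xP).
- by case: (not_infty y yP).
have e01 : / height x = / height y by rewrite -!ell01 // e.
congr Some; apply: seminorm_ext_lin => // c.
have : x (lin c) / height x = y (lin c) / height y by rewrite -!ell_lin // e.
by rewrite /Rdiv e01 => /Rmult_eq_reg_r; apply; apply/Rinv_neq_0_compat/Rgt_not_eq/height_gt0.
Qed.

Lemma ell_dichotomy x u v : is_seminorm abs x -> unit_form u v ->
  abs v <= abs u * height x /\ / height x <= abs u \/ / height x <= ell (Some x) u v.
Proof.
move=> xP uv; have h0 := height_gt0 x; have h1 := height_ge1 x.
have xX := le_height x; have u0 := abs_ge0 u.
case: (Rle_lt_dec (abs v) (abs u * height x)) => le; [left | right].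
  split=> //; rewrite -Rdiv_1_l; apply/Rle_div_l => //.
  by move: uv; rewrite /unit_form; rmax_lra; nra.
have xu : x (u *: 'X)%ring < x v%:P%ring.
  rewrite seminormZ // seminormC //; apply: Rle_lt_trans le.
  exact: Rmult_le_compat_l.
rewrite ell_lform // addrC seminormD_eq // seminormC //.
have -> : abs v = 1 by move: uv; rewrite /unit_form; rmax_lra; nra.
by rewrite Rdiv_1_l; lra.
Qed.

Lemma radius_div_height_le x u v : is_seminorm abs x -> unit_form u v ->
  radius x / height x ^ 2 <= ell (Some x) u v.
Proof.
move=> xP uv; have h0 := height_gt0 x; have hi := Rinv_0_lt_compat _ h0.
have -> : radius x / height x ^ 2 = / height x * (radius x / height x) by field; lra.
have rh0 : 0 <= radius x / height x by apply: Rdiv_le_0_compat => //; exact: radius_ge0.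
case: (ell_dichotomy xP uv) => [[_ le_u]|]; last first.
  apply: Rle_trans; rewrite -[X in _ <= X]Rmult_1_r; apply: Rmult_le_compat_l; first lra.
  by apply/Rle_div_l; rewrite ?Rmult_1_l; last exact: radius_le_height.
have u0 : u != 0%ring by apply/eqP => u0; move: le_u; rewrite u0 abs0; lra.
rewrite ell_lform // seminorm_lform // /Rdiv Rmult_assoc.
apply: Rmult_le_compat => //; first lra.
by apply: Rmult_le_compat_r; [lra | exact: radius_le].
Qed.

Lemma diam_mul_height_le x c : is_seminorm abs x ->
  diam (ell (Some x)) * height x ^ 2 <= x (lin c).
Proof.
move=> xP; have nx := @ell_norm (Some x) xP.
have h0 := height_gt0 x; set D := diam _; have D0 : 0 <= D by exact: join_diam_ge0.
have Dh1 : D * height x <= 1.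
  by apply/Rle_div_r => //; rewrite Rdiv_1_l -ell01 //; exact: diam_le (unit_form01).
case: (Rle_lt_dec (height x) (Rmax 1 (abs c))) => hc.
  have [|e [e0 ae uv]] := @unit_form_scale 1 (- c); first by rewrite oner_neq0.
  have := diam_le nx uv; rewrite -/D -[(1 / e)%ring]mulrC -[(- c / e)%ring]mulrC.
  rewrite (form_normZ nx) ell_lin // absV // ae abs1 absN => le.
  have m1 : 0 < Rmax 1 (abs c) by lra.
  have e2 : / Rmax 1 (abs c) * (x (lin c) / height x) =
     x (lin c) / (Rmax 1 (abs c) * height x) by field; lra.
  rewrite e2 in le; have mh := Rmult_lt_0_compat _ _ m1 h0.
  apply: Rle_trans (proj2 (Rle_div_r _ _ _ mh) le).
  by apply: Rmult_le_compat_l => //; rewrite /= Rmult_1_r; apply: Rmult_le_compat_r; lra.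
have hX : height x = x 'X%ring by move: hc; rewrite /height; rmax_lra.
have := seminormX_le_lin xP c; rewrite -hX.
have : D * height x ^ 2 <= height x.
  rewrite /= Rmult_1_r -Rmult_assoc.
  by have := Rmult_le_compat_r _ _ _ (Rlt_le _ _ h0) Dh1; lra.
by move: hc; rmax_lra.
Qed.

Lemma diamG_diam P : is_berk abs P -> diamG P = diam (ell P).
Proof.
move=> bP; have nP := ell_norm bP; apply: Rle_antisym; last first.
  case: P bP nP => [x|] xP nP; last by have := diam_le nP unit_form01; rewrite /= abs0.
  rewrite /diamG /Plin subr0; apply/Rle_div_r; first exact/pow_lt/height_gt0.
  by apply: radius_ge => // c; exact: diam_mul_height_le.
case: P bP nP => [x|] xP nP; last exact: join_diam_ge0.
apply: diam_ge => // u v uv; rewrite /diamG /Plin subr0.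
exact: radius_div_height_le.
Qed.

(** * Joins in the tree *)

Lemma le_b_refl P : le_b P P.
Proof. by case: P => //= x h; exact: Rle_refl. Qed.

Lemma le_b_anti P Q : le_b P Q -> le_b Q P -> P = Q.
Proof.
case: P Q => [x|] [y|] //= xy yx.
by congr Some; apply/funext => h; exact: Rle_antisym.
Qed.

Lemma bjoinE P Q J : is_join abs P Q J -> bjoin abs P Q = J.
Proof.
move=> joinJ; have : is_join abs P Q (bjoin abs P Q).
  by apply: (epsilon_spec (inhabits None) (is_join abs P Q)); exists J.
case: joinJ => bJ [PJ [QJ leastJ]] [bE [PE [QE leastE]]].
by apply: le_b_anti; [exact: leastE | exact: leastJ].
Qed.

Lemma bjoinC P Q : bjoin abs P Q = bjoin abs Q P.
Proof.
rewrite /bjoin; congr epsilon; apply/funext => J; apply/propext.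
by split=> -[bJ [PJ [QJ least]]]; do 3!split=> //; move=> J' bJ' *; exact: least.
Qed.

Lemma bjoin_infty P : bjoin abs P None = None.
Proof. by apply: bjoinE; split=> //; split; [case: P | split=> // -[]]. Qed.

Lemma bjoin_inftyl P : bjoin abs None P = None.
Proof. by rewrite bjoinC bjoin_infty. Qed.

Lemma bjoin_lin x y j : is_seminorm abs x -> is_seminorm abs y -> is_seminorm abs j ->
  (forall c, j (lin c) = Rmax (x (lin c)) (y (lin c))) ->
  bjoin abs (Some x) (Some y) = Some j.
Proof.
move=> xP yP jP jE; apply: bjoinE; split=> //=.
split; first by apply: seminorm_le_of_lin => // c; rewrite jE; exact: Rmax_l.
split; first by apply: seminorm_le_of_lin => // c; rewrite jE; exact: Rmax_r.
case=> [j'|] //= jP' xj yj; apply: seminorm_le_of_lin => // c.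
by rewrite jE; apply: Rmax_lub.
Qed.

(* Incomparable seminorms, separated by [a] and [b], are joined at the disc [D(a, |a - b|)]. *)
Lemma gauss_at_lin_join x y a b c : is_seminorm abs x -> is_seminorm abs y ->
  y (lin a) < x (lin a) -> x (lin b) < y (lin b) ->
  gauss_at a (abs (a - b)) (lin c) = Rmax (x (lin c)) (y (lin c)).
Proof.
move=> xP yP ya xb; rewrite gauss_at_lin; last exact: abs_ge0.
have ab := absBC a b.
have [xa [yb [xb' ya']]] : x (lin a) = abs (a - b) /\ y (lin b) = abs (a - b) /\
    x (lin b) < abs (a - b) /\ y (lin a) < abs (a - b).
  have := seminorm_lin_le xP a b; have := seminorm_lin_le yP b a.
  have := abs_sub_le_lin xP a b; have := abs_sub_le_lin yP a b.
  by rmax_lra.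
have ac := absBC a c; apply: Rle_antisym.
- apply: Rmax_lub; have := abs_sub_trans a c b; have := abs_sub_le_lin xP c b;
    have := abs_sub_le_lin yP a c; by rmax_lra.
- apply: Rmax_lub; [have := seminorm_lin_le xP c a | have := seminorm_lin_le yP c a];
    by rmax_lra.
Qed.

Lemma seminorm_join_exists x y : is_seminorm abs x -> is_seminorm abs y ->
  exists2 j, is_seminorm abs j & forall c, j (lin c) = Rmax (x (lin c)) (y (lin c)).
Proof.
move=> xP yP.
case: (EM (forall c, x (lin c) <= y (lin c))) => [le|/existsNP[a /Rnot_le_lt ya]].
  by exists y => // c; rewrite Rmax_right.
case: (EM (forall c, y (lin c) <= x (lin c))) => [le|/existsNP[b /Rnot_le_lt xb]].
  by exists x => // c; rewrite Rmax_left.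
exists (gauss_at a (abs (a - b))); first exact/seminorm_gauss_at/abs_ge0.
by move=> c; exact: gauss_at_lin_join.
Qed.

Lemma berk_zetaG : is_berk abs (zetaG abs).
Proof. exact: seminorm_gauss_norm. Qed.

Lemma zetaGE : zetaG abs = Some (gauss_at 0 1).
Proof. by rewrite /zetaG gauss_normE gauss_at0. Qed.

Definition hull x : {poly K} -> R := gauss_at 0 (height x).

Lemma seminorm_hull x : is_seminorm abs (hull x).
Proof. exact/seminorm_gauss_at/Rlt_le/height_gt0. Qed.

Lemma hull_lin x c : hull x (lin c) = Rmax (height x) (abs c).
Proof. by rewrite /hull gauss_at_lin ?sub0r ?absN //; exact/Rlt_le/height_gt0. Qed.

Lemma hull_le x y : height x <= height y -> forall h, hull x h <= hull y h.
Proof.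
move=> le; apply: seminorm_le_of_lin; try exact: seminorm_hull.
by move=> c; rewrite !hull_lin; apply: Rmax_le_compat => //; exact: Rle_refl.
Qed.

Lemma bjoin_zetaG x : is_seminorm abs x -> bjoin abs (Some x) (zetaG abs) = Some (hull x).
Proof.
move=> xP; rewrite zetaGE; apply: bjoin_lin => // [||c].
- by apply: seminorm_gauss_at; lra.
- exact: seminorm_hull.
rewrite hull_lin gauss_at_lin ?sub0r ?absN; last lra.
have := seminormX_le_lin xP c; have := seminorm_lin_leX xP c.
by rewrite /height; rmax_lra.
Qed.

Lemma medianE P Q S M :
  M = bjoin abs P Q \/ M = bjoin abs Q S \/ M = bjoin abs P S ->
  le_b M (bjoin abs P Q) -> le_b M (bjoin abs Q S) -> le_b M (bjoin abs P S) ->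
  median abs P Q S = M.
Proof.
move=> joinM MPQ MQS MPS.
pose is_median M := (M = bjoin abs P Q \/ M = bjoin abs Q S \/ M = bjoin abs P S) /\
    le_b M (bjoin abs P Q) /\ le_b M (bjoin abs Q S) /\ le_b M (bjoin abs P S).
have [joinE [EPQ [EQS EPS]]] : is_median (median abs P Q S).
  by apply: (epsilon_spec (inhabits None) is_median); exists M.
apply: le_b_anti.
- by case: joinM => [|[]] ->.
- by case: joinE => [|[]] ->.
Qed.

Lemma medianCA P Q S : median abs P Q S = median abs Q P S.
Proof.
rewrite /median (bjoinC Q P); congr epsilon; apply/funext => M; apply/propext.
by split; tauto.
Qed.

Lemma medianAC P Q S : median abs P Q S = median abs P S Q.
Proof.
rewrite /median (bjoinC S Q); congr epsilon; apply/funext => M; apply/propext.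
by split; tauto.
Qed.

Lemma height_hull x : height (hull x) = height x.
Proof.
rewrite {1}/height /hull gauss_atX ?abs0; last exact/Rlt_le/height_gt0.
by have := height_ge1 x; rmax_lra.
Qed.

Lemma ell_hull x u v : ell (Some (hull x)) u v = Rmax (abs u) (abs v / height x).
Proof.
have h0 := height_gt0 x; rewrite ell_lform ?height_hull; last exact: seminorm_hull.
rewrite /hull gauss_at_lform; last exact: Rlt_le.
rewrite mulr0 add0r Rmax_div //; congr Rmax.
by field; lra.
Qed.

Lemma ell_le_hull x y u v : is_seminorm abs x -> height y <= height x ->
  ell (Some x) u v <= ell (Some (hull y)) u v.
Proof.
move=> xP yx; have hx := height_gt0 x; have hy := height_gt0 y.
rewrite ell_hull ell_lform //.
apply: (Rle_trans _ (Rmax (abs u * height x) (abs v) / height x)).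
  apply: Rmult_le_compat_r; first exact/Rlt_le/Rinv_0_lt_compat.
  apply: Rle_trans (seminormD xP _ _) _; rewrite seminormZ // seminormC //.
  apply: Rmax_le_compat; last exact: Rle_refl.
  by apply: Rmult_le_compat_l; [exact: abs_ge0 | exact: le_height].
rewrite Rmax_div //; apply: Rmax_le_compat; first by apply: Req_le; field; lra.
by apply: Rmult_le_compat_l; [exact: abs_ge0 | exact: Rinv_le_contravar].
Qed.

Lemma diam_hull_le x : diam (ell (Some (hull x))) <= / height x.
Proof.
have nh := @ell_norm (Some (hull x)) (seminorm_hull x).
apply: Rle_trans (diam_le nh unit_form01) _.
by rewrite ell01 ?height_hull; [exact: Rle_refl | exact: seminorm_hull].
Qed.

Record ell_join P Q J : Prop := EllJoin {
  ell_join_berk : is_berk abs J;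
  ell_join_l : forall u v, unit_form u v -> ell P u v <= ell J u v;
  ell_join_r : forall u v, unit_form u v -> ell Q u v <= ell J u v;
  ell_join_diam : diam (ell J) <= join_diam (ell P) (ell Q)
}.

Lemma ell_joinC P Q J : ell_join P Q J -> ell_join Q P J.
Proof. by case=> bJ PJ QJ dJ; split=> //; rewrite join_diamC. Qed.

Lemma joinGC P Q : joinG abs P Q = joinG abs Q P.
Proof. exact: medianCA. Qed.

Lemma joinG_infty : joinG abs None None = None.
Proof. by apply: medianE; rewrite ?bjoin_inftyl //; left. Qed.

Lemma ell_join_infty : ell_join None None (joinG abs None None).
Proof. by rewrite joinG_infty; split=> // *; exact: Rle_refl. Qed.

Lemma joinG_infty_Some y : is_seminorm abs y -> joinG abs None (Some y) = Some (hull y).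
Proof.
move=> yP; apply: medianE; rewrite ?bjoin_inftyl ?bjoin_zetaG //.
- by right; left.
- exact: le_b_refl.
Qed.

Lemma ell_join_infty_Some y : is_seminorm abs y ->
  ell_join None (Some y) (joinG abs None (Some y)).
Proof.
move=> yP; rewrite joinG_infty_Some //; split=> [|u v _|u v _|].
- exact: seminorm_hull.
- by rewrite ell_hull; exact: Rmax_l.
- by apply: ell_le_hull => //; exact: Rle_refl.
apply: Rle_trans (diam_hull_le y) _; apply: join_diam_ge => [|u v uv].
  exact: (@ell_norm None).
by case: (ell_dichotomy yP uv) => [[_ le]|le]; apply: Rle_trans le _;
  [exact: Rmax_l | exact: Rmax_r].
Qed.

Lemma joinG_height_lt x y : is_seminorm abs x -> is_seminorm abs y ->
  height x < height y -> joinG abs (Some x) (Some y) = Some (hull x).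
Proof.
move=> xP yP lt; have [j jP jE] := seminorm_join_exists xP yP.
apply: medianE; rewrite ?(bjoin_lin xP yP jP jE) ?bjoin_zetaG //.
- by right; right.
- apply: seminorm_le_of_lin => // [|c]; first exact: seminorm_hull.
  rewrite hull_lin jE; have := abs_le_lin xP c; have := seminormX_le_lin yP c.
  by move: lt; rewrite /height; rmax_lra.
- exact/hull_le/Rlt_le.
- exact: le_b_refl.
Qed.

Lemma ell_join_height_lt x y : is_seminorm abs x -> is_seminorm abs y ->
  height x < height y -> ell_join (Some x) (Some y) (joinG abs (Some x) (Some y)).
Proof.
move=> xP yP lt; rewrite joinG_height_lt //; split=> [|u v _|u v _|].
- exact: seminorm_hull.
- by apply: ell_le_hull => //; exact: Rle_refl.
- by apply: ell_le_hull => //; exact: Rlt_le.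
apply: Rle_trans (diam_hull_le x) _; apply: join_diam_ge => [|u v uv].
  exact: (@ell_norm (Some x)).
have [[vu xu]|le] := ell_dichotomy xP uv; last exact: Rle_trans le (Rmax_l _ _).
apply: Rle_trans (Rmax_r _ _); apply: Rle_trans xu _; apply: Req_le.
have hx := height_ge1 x; have yX : y 'X%ring = height y by move: lt; rewrite /height; rmax_lra.
have u0 : 0 < abs u.
  case: (abs_ge0 u) => // u0; move: uv vu; rewrite /unit_form -u0 Rmult_0_l.
  by rmax_lra.
rewrite ell_lform // seminormD_eq // seminormZ // ?seminormC // yX; first by field; lra.
apply: Rle_lt_trans vu _; exact: Rmult_lt_compat_l.
Qed.

Lemma joinG_height_eq x y j : is_seminorm abs x -> is_seminorm abs y ->
  is_seminorm abs j -> (forall c, j (lin c) = Rmax (x (lin c)) (y (lin c))) ->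
  height x = height y -> joinG abs (Some x) (Some y) = Some j.
Proof.
move=> xP yP jP jE hxy.
have j_hull : le_b (Some j) (Some (hull x)).
  apply: seminorm_le_of_lin => // [|c]; first exact: seminorm_hull.
  rewrite hull_lin jE; have := seminorm_lin_leX xP c; have := seminorm_lin_leX yP c.
  by have := le_height x; have := le_height y; rewrite -hxy; rmax_lra.
apply: medianE; rewrite ?(bjoin_lin xP yP jP jE) ?bjoin_zetaG // /hull -?hxy //.
- by left.
- exact: le_b_refl.
Qed.

Lemma ell_join_height_eq x y : is_seminorm abs x -> is_seminorm abs y ->
  height x = height y -> ell_join (Some x) (Some y) (joinG abs (Some x) (Some y)).
Proof.
move=> xP yP hxy; have [j jP jE] := seminorm_join_exists xP yP.
rewrite (joinG_height_eq xP yP jP jE hxy).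
have hj : height j = height x.
  have jX : j 'X%ring = Rmax (x 'X%ring) (y 'X%ring) by have := jE 0%ring; rewrite !subr0.
  by move: hxy; rewrite /height jX; rmax_lra.
have ellj u v : ell (Some j) u v = Rmax (ell (Some x) u v) (ell (Some y) u v).
  rewrite !ell_lform // hj -hxy -Rmax_div; last exact: height_gt0.
  congr (_ / _); have [->|u0] := eqVneq u 0%ring.
    by rewrite lform0 !seminormC // Rmax_left //; exact: Rle_refl.
  by rewrite !seminorm_lform // jE -Rmult_max_distr_l //; exact: abs_ge0.
split=> // [u v _|u v _|]; try (by rewrite ellj; (exact: Rmax_l || exact: Rmax_r)).
apply: join_diam_ge => [|u v uv]; first exact: (@ell_norm (Some x)).
by rewrite -ellj; apply: diam_le => //; exact: (@ell_norm (Some j)).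
Qed.

Lemma ell_joinG P Q : is_berk abs P -> is_berk abs Q -> ell_join P Q (joinG abs P Q).
Proof.
case: P Q => [x|] [y|] xP yP.
- have [lt|[e|gt]] := Rtotal_order (height x) (height y).
  + exact: ell_join_height_lt.
  + exact: ell_join_height_eq.
  + by rewrite joinGC; apply/ell_joinC/ell_join_height_lt.
- by rewrite joinGC; apply/ell_joinC/ell_join_infty_Some.
- exact: ell_join_infty_Some.
- exact: ell_join_infty.
Qed.

Lemma diam_ell_joinG P Q : is_berk abs P -> is_berk abs Q ->
  diam (ell (joinG abs P Q)) = join_diam (ell P) (ell Q).
Proof.
move=> bP bQ; have [bJ PJ QJ dJ] := ell_joinG bP bQ; apply: Rle_antisym => //.
apply: diam_ge => [|u v uv]; first exact: ell_norm.
apply: Rle_trans (join_diam_le _ (ell_norm bP) uv) _.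
by apply: Rmax_lub; [exact: PJ | exact: QJ].
Qed.

Lemma berk_dist_ell P Q : is_berk abs P -> is_berk abs Q ->
  berk_dist abs P Q = form_dist (ell P) (ell Q).
Proof.
move=> bP bQ; rewrite /berk_dist !diamG_diam ?diam_ell_joinG //.
exact: ell_join_berk (ell_joinG bP bQ).
Qed.

Lemma median_zetaG_absorb P Q : is_berk abs P -> is_berk abs Q ->
  join_diam (ell P) (ell Q) <= diam (ell Q) -> median abs P (zetaG abs) Q = Q.
Proof.
move=> bP bQ le; rewrite medianAC -/(joinG abs P Q); have [bJ _ QJ _] := ell_joinG bP bQ.
apply/esym/ell_inj => //; apply: form_norm_eq_of_diam_le => //; try exact: ell_norm.
by rewrite diam_ell_joinG.
Qed.

(** * Rational maps *)

Definition no_common_zero f g : Prop :=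
  forall x, is_seminorm abs x -> 0 < Rmax (x f) (x g).

Lemma no_common_zeroC f g : no_common_zero f g -> no_common_zero g f.
Proof. by move=> nz x xP; rewrite Rmax_comm; exact: nz. Qed.

Lemma no_common_zero_coprime f g : coprimep f g -> no_common_zero f g.
Proof.
move=> /Bezout_eq1_coprimepP [[a b] /= bezout] x xP.
have := seminormD xP (a * f)%ring (b * g)%ring; rewrite bezout seminorm1 // !seminormM //.
have f0 := seminorm_ge0 xP f; have g0 := seminorm_ge0 xP g => le.
apply: Rnot_le_lt => max0; move: le.
have -> : x f = 0 by have := Rmax_l (x f) (x g); lra.
have -> : x g = 0 by have := Rmax_r (x f) (x g); lra.
by rewrite !Rmult_0_r; rmax_lra.
Qed.

Lemma no_common_zero_comp f g q : no_common_zero f g ->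
  no_common_zero (f \Po q)%ring (g \Po q)%ring.
Proof. by move=> nz x xP; exact: (nz _ (seminorm_comp q xP)). Qed.

(* [g ^ n h(f / g)], a polynomial as soon as [deg h <= n]. *)
Definition hom_comp n f g h : {poly K} :=
  (\sum_(i < n.+1) h`_i *: (f ^+ i * g ^+ (n - i)%N))%ring.

Lemma comp_poly_ratE f g h : comp_poly_rat f g h = hom_comp (size h).-1 f g h.
Proof.
rewrite /comp_poly_rat /hom_comp; case sh : (size h) => [|n] //.
have -> : h = 0%ring by apply/eqP; rewrite -size_poly_eq0 sh.
by rewrite big_ord0 big_ord1 coef0 scale0r.
Qed.

Definition frac_eval f g h : {fraction {poly K}} :=
  ((map_poly (@tofrac {poly K} \o polyC) h).[tofrac f / tofrac g])%ring.

Lemma frac_evalM f g h k :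
  (frac_eval f g (h * k) = frac_eval f g h * frac_eval f g k)%ring.
Proof. by rewrite /frac_eval rmorphM hornerM. Qed.

Lemma tofrac_hom_comp n f g h : g != 0%ring -> (size h <= n.+1)%N ->
  tofrac (hom_comp n f g h) = (tofrac g ^+ n * frac_eval f g h)%ring.
Proof.
move=> g0 hn; have g0' : tofrac g != 0%ring by rewrite tofrac_eq0.
rewrite /frac_eval (horner_coef_wide _ (n := n.+1)); last first.
  rewrite size_map_inj_poly ?raddf0 // => p q /eqP.
  by rewrite /= tofrac_eq => /eqP/polyC_inj.
rewrite /hom_comp rmorph_sum mulr_sumr; apply: eq_bigr => -[i i_n] _.
rewrite coef_map /= -mul_polyC !rmorphM !rmorphXn /= [RHS]mulrCA; congr (_ * _)%ring.
rewrite expr_div_n mulrCA; congr (_ * _)%ring.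
by rewrite -{2}(subnK (i_n : (i <= n)%N)) exprD mulfK ?expf_neq0.
Qed.

Lemma hom_compM n (k : nat) f g p q :
  g != 0%ring -> (size p <= n.+1)%N -> (size q <= k.+1)%N ->
  (hom_comp (n + k)%N f g (p * q) = hom_comp n f g p * hom_comp k f g q)%ring.
Proof.
move=> g0 pn qk; apply/eqP; rewrite -tofrac_eq rmorphM /= !tofrac_hom_comp //.
  by rewrite frac_evalM exprD mulrACA.
apply: leq_trans (size_polyMleq _ _) _.
by have := leq_add pn qk; rewrite addSn addnS; case: (size p + size q)%N.
Qed.

Lemma hom_compC n f g c : hom_comp n f g c%:P%ring = (c *: g ^+ n)%ring.
Proof.
rewrite /hom_comp big_ord_recl coefC /= expr0 mul1r subn0 big1 ?addr0 // => i _.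
by rewrite coefC /= scale0r.
Qed.

Lemma hom_compD n f g h k :
  (hom_comp n f g (h + k) = hom_comp n f g h + hom_comp n f g k)%ring.
Proof. by rewrite /hom_comp -big_split; apply: eq_bigr => i _; rewrite coefD scalerDl. Qed.

Lemma hom_compZ n f g c h : (hom_comp n f g (c *: h) = c *: hom_comp n f g h)%ring.
Proof. by rewrite /hom_comp scaler_sumr; apply: eq_bigr => i _; rewrite coefZ scalerA. Qed.

Lemma hom_comp_pencil n f g h k u v :
  hom_comp n f g (pencil h k u v) = pencil (hom_comp n f g h) (hom_comp n f g k) u v.
Proof. by rewrite hom_compD !hom_compZ. Qed.

Lemma hom_comp1X f g : hom_comp 1 f g 'X%ring = f.
Proof.
rewrite /hom_comp big_ord_recl big_ord1 !coefX /= scale0r add0r scale1r.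
by rewrite expr1 expr0 mulr1.
Qed.

Lemma seminorm_neq0 x g : is_seminorm abs x -> x g <> 0 -> g != 0%ring /\ 0 < x g.
Proof.
move=> xP xg; split; first by apply/eqP => g0; apply: xg; rewrite g0 seminorm0.
by case: (seminorm_ge0 xP g) => // /esym.
Qed.

Lemma pushE n f g x h : is_seminorm abs x -> x g <> 0 -> (size h <= n.+1)%N ->
  push f g x h = x (hom_comp n f g h) / x g ^ n.
Proof.
move=> xP xg hn; have [g0 xg0] := seminorm_neq0 xP xg.
have [hn' xgn] : ((size h).-1 <= n)%N /\ forall k : nat, x g ^ k <> 0.
  by split=> [|k]; [case: (size h) hn | exact: pow_nonzero].
rewrite /push comp_poly_ratE; have := leqSpred (size h).
move: (size h).-1 hn' => k kn hk; rewrite -(subnKC kn) -[h in RHS]mulr1.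
rewrite hom_compM ?size_poly1 // hom_compC scale1r.
rewrite seminormM // seminormX // -[(_ + _)%N]/(_ + _)%coq_nat pow_add.
by field; split.
Qed.

Lemma seminorm_push f g x : is_seminorm abs x -> x g <> 0 -> is_seminorm abs (push f g x).
Proof.
move=> xP xg; have [g0 xg0] := seminorm_neq0 xP xg.
have xgn n : 0 < x g ^ n by exact: pow_lt.
split; first by move=> h; apply: Rdiv_le_0_compat => //; exact: seminorm_ge0.
split=> [h k|].
  rewrite /Pmul (pushE (n := (size h).-1 + (size k).-1)%N) //.
    rewrite hom_compM ?leqSpred // seminormM // !(pushE _ xP xg (leqSpred _)).
    rewrite -[(_ + _)%N]/(_ + _)%coq_nat pow_add.
    by field; split; exact/Rgt_not_eq/xgn.
  apply: leq_trans (size_polyMleq _ _) _.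
  have := leq_add (leqSpred (size h)) (leqSpred (size k)); rewrite addSn addnS.
  by case: (size h + size k)%N.
split=> [h k|c].
  pose n := maxn (size h) (size k).
  have hn : (size h <= n.+1)%N by rewrite leqW // leq_maxl.
  have kn : (size k <= n.+1)%N by rewrite leqW // leq_maxr.
  have hkn : (size (h + k)%ring <= n.+1)%N by rewrite leqW // size_polyD.
  rewrite /Padd (pushE f xP xg hn) (pushE f xP xg kn) (pushE f xP xg hkn).
  rewrite hom_compD -Rmax_div //; apply: Rmult_le_compat_r; last exact: seminormD.
  exact/Rlt_le/Rinv_0_lt_compat.
rewrite /Pconst (pushE (n := 0%N)) //; last by rewrite size_polyC; case: (c != 0%ring).
by rewrite hom_compC expr0 seminormZ // seminorm1 // /=; field.
Qed.

Lemma pencil_norm_scale x y f g h k m : 0 < m ->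
  (forall u v, y (pencil h k u v) = x (pencil f g u v) / m) ->
  pencil_norm y h k = pencil_norm x f g.
Proof.
move=> m0 yE; apply/funeq2P => u v; rewrite /pencil_norm yE.
have := yE 1%ring 0%ring; have := yE 0%ring 1%ring; rewrite !pencil10 !pencil01 => -> ->.
rewrite -Rmax_div //; case: (Req_dec (Rmax (x f) (x g)) 0) => [->|nz].
  by rewrite /Rdiv Rmult_0_l Rinv_0 !Rmult_0_r.
by field; lra.
Qed.

Lemma ell_push f g x : is_seminorm abs x -> x g <> 0 ->
  ell (Some (push f g x)) = pencil_norm x f g.
Proof.
move=> xP xg; have [g0 xg0] := seminorm_neq0 xP xg.
apply: (pencil_norm_scale (m := x g)) => // u v.
have X1 : (size ('X : {poly K})%ring <= 2)%N by rewrite size_polyX.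
have one1 : (size (1 : {poly K})%ring <= 2)%N by rewrite size_poly1.
rewrite (pushE _ xP xg (n := 1%N)); last exact: size_pencil.
by rewrite hom_comp_pencil hom_comp1X -polyC1 hom_compC scale1r expr1 pow_1.
Qed.

Lemma pencil_norm_pole f g x : is_seminorm abs x -> x g = 0 -> 0 < x f ->
  pencil_norm x f g = ell None.
Proof.
move=> xP xg xf; apply/funeq2P => u v; rewrite /pencil_norm xg Rmax_left; last lra.
have vg : x (v *: g)%ring = 0 by rewrite seminormZ // xg Rmult_0_r.
have -> : x (pencil f g u v) = abs u * x f; last by rewrite /=; field; lra.
have := seminormD xP (u *: f)%ring (v *: g)%ring.
have := seminorm_le_addl xP (u *: f)%ring (v *: g)%ring.
rewrite -/(pencil f g u v) vg seminormZ //; have := seminorm_ge0 xP (pencil f g u v).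
by have := Rmult_le_pos _ _ (abs_ge0 u) (Rlt_le _ _ xf); rmax_lra.
Qed.

Lemma berk_phi_Some f g x : is_seminorm abs x -> is_berk abs (phi_act abs f g (Some x)).
Proof. by move=> xP; rewrite /phi_act; case: Req_EM_T => // xg; exact: seminorm_push. Qed.

Lemma ell_phi_Some f g x : is_seminorm abs x -> 0 < Rmax (x f) (x g) ->
  ell (phi_act abs f g (Some x)) = pencil_norm x f g.
Proof.
move=> xP m0; rewrite /phi_act; case: Req_EM_T => [xg|xg]; last exact: ell_push.
rewrite pencil_norm_pole //; move: m0; rewrite xg Rmax_left //; exact: seminorm_ge0.
Qed.

Lemma berk_typeI c : is_berk abs (typeI abs c).
Proof. exact: seminorm_eval. Qed.

Lemma ell_typeI c u v : ell (typeI abs c) u v = abs (u * c + v) / Rmax 1 (abs c).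
Proof.
rewrite /typeI ell_lform; last exact: seminorm_eval.
by rewrite /height /Peval !hornerE.
Qed.

Lemma ell_typeI_div a b u v : b != 0%ring ->
  ell (typeI abs (a / b)) u v = abs (u * a + v * b) / Rmax (abs a) (abs b).
Proof.
move=> b0; have ab := abs_gt0 b0; rewrite ell_typeI.
have -> : (u * (a / b) + v = (u * a + v * b) / b)%ring by rewrite mulrDl mulfK // mulrA.
have -> : Rmax 1 (abs (a / b)) = Rmax (abs a) (abs b) / abs b.
  by rewrite Rmax_div // Rmax_comm Rdiv_diag ?absM ?absV //; lra.
rewrite [abs (_ / b)]absM absV //.
have m0 : 0 < Rmax (abs a) (abs b) by apply: Rlt_le_trans ab (Rmax_r _ _).
by field; lra.
Qed.

Lemma value_at_infinityE f g : (size f <= size g)%N -> g != 0%ring ->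
  value_at_infinity f g = (f`_(size g).-1 / lead_coef g)%ring.
Proof.
move=> fg g0; rewrite /value_at_infinity -[ltn _ _]/((size f < size g)%N).
case: ltnP => gf; first by rewrite nth_default ?mul0r // -ltnS prednK // lt0n size_poly_eq0.
by rewrite /lead_coef (anti_leq (_ : (size f <= size g <= size f)%N)) // fg.
Qed.

Definition rev_poly d h : {poly K} := hom_comp d 1 'X h.

Lemma rev_poly0 d h : ((rev_poly d h).[0] = h`_d)%ring.
Proof.
rewrite /rev_poly /hom_comp horner_sum big_ord_recr big1 /= => [|i _].
  by rewrite add0r hornerZ expr1n mul1r subnn expr0 hornerE mulr1.
rewrite hornerZ expr1n mul1r hornerXn expr0n subn_eq0 leqNgt ltn_ord /=.
by rewrite mulr0.
Qed.

Lemma rev_poly_pencil d f g u v :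
  rev_poly d (pencil f g u v) = pencil (rev_poly d f) (rev_poly d g) u v.
Proof. exact: hom_comp_pencil. Qed.

Lemma size_rev_poly d h : (size (rev_poly d h) <= d.+1)%N.
Proof.
rewrite /rev_poly /hom_comp.
apply: (big_ind (fun p : {poly K} => (size p <= d.+1)%N)) => [|p q pd qd|i _].
- by rewrite size_poly0.
- by apply: leq_trans (size_polyD _ _) _; rewrite geq_max pd qd.
- apply: leq_trans (size_scale_leq _ _) _.
  by rewrite expr1n mul1r size_polyXn ltnS leq_subr.
Qed.

Lemma phi_infty f g d : g != 0%ring -> d = (maxn (size f) (size g)).-1 ->
  [/\ is_berk abs (phi_act abs f g None), 0 < Rmax (abs f`_d) (abs g`_d) &
    ell (phi_act abs f g None) =
      pencil_norm (fun h => abs h.[0]) (rev_poly d f) (rev_poly d g)].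
Proof.
move=> g0 dE; pose ev0 h := abs h.[0]%ring.
have evE u v : pencil_norm ev0 (rev_poly d f) (rev_poly d g) u v =
    abs (u * f`_d + v * g`_d) / Rmax (abs f`_d) (abs g`_d).
  by rewrite /pencil_norm -rev_poly_pencil /ev0 !rev_poly0 pencil_coef.
rewrite /phi_act -/ev0 -[ltn _ _]/((size g < size f)%N); case: ltnP => [gf|fg].
- have fd : (f`_d != 0)%ring.
    rewrite dE (maxn_idPl (ltnW gf)) -/(lead_coef f) lead_coef_eq0 -size_poly_eq0.
    by case: (size f) gf.
  have gd : (g`_d = 0)%ring.
    by rewrite nth_default // dE (maxn_idPl (ltnW gf)); case: (size f) gf.
  have afd := abs_gt0 fd.
  split=> //; first by rewrite gd abs0 Rmax_left; lra.
  apply/funeq2P => u v; rewrite evE gd mulr0 addr0 absM abs0 Rmax_left; last exact: abs_ge0.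
  by rewrite Rmult_div_l //; apply: Rgt_not_eq; exact: afd.
- have gd : (g`_d = lead_coef g)%ring by rewrite dE (maxn_idPr fg).
  have gd0 : lead_coef g != 0%ring by rewrite lead_coef_eq0.
  split; first exact: berk_typeI.
    by rewrite gd; apply: Rlt_le_trans (abs_gt0 gd0) (Rmax_r _ _).
  apply/funeq2P => u v; rewrite evE gd value_at_infinityE // ell_typeI_div //.
  by rewrite dE (maxn_idPr fg).
Qed.

Lemma berk_phi f g P : g != 0%ring -> is_berk abs P -> is_berk abs (phi_act abs f g P).
Proof.
move=> g0; case: P => [x|] bP; first exact: berk_phi_Some.
by have [] := phi_infty g0 (erefl (maxn (size f) (size g)).-1).
Qed.

(** * The inversion [1 / T] *)

Definition berk_inv P : bpoint K := phi_act abs 1%ring 'X%ring P.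

Lemma berk_berk_inv P : is_berk abs P -> is_berk abs (berk_inv P).
Proof. by apply: berk_phi; rewrite polyX_eq0. Qed.

Lemma ell_berk_inv P : is_berk abs P -> ell (berk_inv P) = swap (ell P).
Proof.
case: P => [x|] bP.
  rewrite ell_phi_Some //; first exact: pencil_norm_swap.
  by rewrite seminorm1 //; apply: Rlt_le_trans Rlt_0_1 (Rmax_l _ _).
have X0 : ('X : {poly K})%ring != 0%ring by rewrite polyX_eq0.
have dE : 1%N = (maxn (size (1 : {poly K})%ring) (size ('X : {poly K})%ring)).-1.
  by rewrite size_poly1 size_polyX.
have [_ _ ->] := phi_infty X0 dE; apply/funeq2P => u v.
rewrite /pencil_norm -rev_poly_pencil !rev_poly0 pencil_coef coef1 coefX /=.
by rewrite mulr0 mulr1 add0r abs0 abs1 Rmax_right ?Rdiv_1_r //; lra.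
Qed.

Lemma berk_invK P : is_berk abs P -> berk_inv (berk_inv P) = P.
Proof.
move=> bP; have b1 := berk_berk_inv bP; have b2 := berk_berk_inv b1.
by apply: ell_inj => //; rewrite !ell_berk_inv.
Qed.

Lemma join_diam_berk_inv P Q : is_berk abs P -> is_berk abs Q ->
  join_diam (ell (berk_inv P)) (ell (berk_inv Q)) = join_diam (ell P) (ell Q).
Proof. by move=> bP bQ; rewrite !ell_berk_inv // join_diam_swap //; exact: ell_norm. Qed.

Lemma berk_inv_zetaG : berk_inv (zetaG abs) = zetaG abs.
Proof.
have bG := berk_zetaG; apply: ell_inj => //; first exact: berk_berk_inv.
have g1 := seminorm_gauss_at 0 Rle_0_1.
have heightG : height (gauss_at 0 1) = 1.
  by rewrite /height gauss_atX ?abs0 ?Rmax_left; lra.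
have ellG u v : ell (zetaG abs) u v = Rmax (abs u) (abs v).
  rewrite zetaGE ell_lform // heightG Rdiv_1_r gauss_at_lform; last lra.
  by rewrite Rmult_1_r mulr0 add0r.
by rewrite ell_berk_inv //; apply/funeq2P => u v; rewrite /swap !ellG Rmax_comm.
Qed.

Lemma classical_berk_inv b : classical_point abs (berk_inv (typeI abs b)).
Proof.
have bt := berk_typeI b; have [b0|b0] := eqVneq b 0%ring.
  left; rewrite /berk_inv /phi_act /=; case: Req_EM_T => //.
  by rewrite /Peval hornerX b0 abs0.
right; exists (1 / b)%ring; apply: ell_inj; [exact: berk_berk_inv | exact: berk_typeI |].
rewrite ell_berk_inv //; apply/funeq2P => u v.
by rewrite /swap ell_typeI ell_typeI_div // mulr1 abs1 addrC.
Qed.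

Lemma seminorm_eq_eval0 x : is_seminorm abs x -> x 'X%ring = 0 ->
  x = (fun h => abs h.[0]).
Proof.
move=> xP xX; apply: seminorm_ext_lin => // [|c]; first exact: seminorm_eval.
rewrite hornerXsubC sub0r absN; have := seminorm_ge0 xP (lin c); have := abs_ge0 c.
have := abs_le_lin xP c; have := seminorm_lin_leX xP c; rewrite xX.
by rmax_lra.
Qed.

Section Reverse.
Variables (f g : {poly K}) (d : nat).
Hypothesis g0 : g != 0%ring.
Hypothesis cop : coprimep f g.
Hypothesis dE : d = (maxn (size f) (size g)).-1.

Lemma size_num_le : (size f <= d.+1)%N.
Proof. by rewrite dE (leq_trans (leq_maxl _ (size g))) // leqSpred. Qed.

Lemma size_den_le : (size g <= d.+1)%N.
Proof. by rewrite dE (leq_trans (leq_maxr (size f) _)) // leqSpred. Qed.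

Lemma pencil_norm_push_inv x : is_seminorm abs x -> x 'X%ring <> 0 ->
  pencil_norm (push 1 'X x) f g = pencil_norm x (rev_poly d f) (rev_poly d g).
Proof.
move=> xP xX; have [_ X0] := seminorm_neq0 xP xX.
apply: (pencil_norm_scale (m := x 'X%ring ^ d)) => [|u v]; first exact: pow_lt.
rewrite (pushE _ xP xX (size_pencil u v size_num_le size_den_le)).
by rewrite -/(rev_poly d _) rev_poly_pencil.
Qed.

Lemma no_common_zero_rev : no_common_zero (rev_poly d f) (rev_poly d g).
Proof.
move=> x xP; case: (Req_dec (x 'X%ring) 0) => [x0|x0].
  rewrite (seminorm_eq_eval0 xP x0) !rev_poly0.
  by have [_ ] := phi_infty g0 dE.
have [_ X0] := seminorm_neq0 xP x0; have Xd : 0 < x 'X%ring ^ d by exact: pow_lt.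
have := no_common_zero_coprime cop (seminorm_push 1 xP x0).
rewrite (pushE _ xP x0 size_num_le) (pushE _ xP x0 size_den_le) -Rmax_div //.
by move=> /Rlt_div_r; rewrite Rmult_0_l; apply.
Qed.

Lemma phi_berk_inv x : is_seminorm abs x -> phi_act abs f g (berk_inv (Some x)) =
  phi_act abs (rev_poly d f) (rev_poly d g) (Some x).
Proof.
move=> xP; have bI : is_berk abs (berk_inv (Some x)) by exact: (@berk_berk_inv (Some x)).
apply: ell_inj; [exact: berk_phi | exact: berk_phi_Some |].
rewrite (ell_phi_Some xP (no_common_zero_rev xP)) {bI}.
rewrite /berk_inv {2}/phi_act; case: Req_EM_T => x0 /=.
  by rewrite (seminorm_eq_eval0 xP x0); have [_ _] := phi_infty g0 dE.
have pP := seminorm_push 1 xP x0.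
by rewrite ell_phi_Some ?pencil_norm_push_inv //; exact: no_common_zero_coprime.
Qed.

End Reverse.

(** * Balls *)

(* [M] is the point [Q_{A,r}] of the path from [A] to the Gauss point. *)
Definition is_Qpt A r M : Prop :=
  [/\ is_berk abs M, join_diam (ell A) (ell M) = r & diam (ell M) = r].

Lemma is_Qpt_Qpt A M r : is_berk abs A -> is_Qpt A r M -> is_Qpt A r (Qpt abs A r).
Proof.
move=> bA [bM AM MM].
pose good Q := is_berk abs Q /\ on_path abs A (zetaG abs) Q /\ diamG Q = r.
have [bQ [pathQ dQ]] : good (Qpt abs A r).
  apply: (epsilon_spec (inhabits None) good); exists M; split=> //.
  split; last by rewrite diamG_diam.
  by apply: median_zetaG_absorb => //; rewrite AM MM; exact: Rle_refl.
have QQ : diam (ell (Qpt abs A r)) = r by rewrite -diamG_diam.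
have joinQ : joinG abs A (Qpt abs A r) = Qpt abs A r by rewrite /joinG medianAC.
by split=> //; rewrite -(diam_ell_joinG bA bQ) joinQ.
Qed.

Lemma is_Qpt_berk_inv A M r : is_berk abs A -> is_Qpt A r M ->
  is_Qpt (berk_inv A) r (berk_inv M).
Proof.
move=> bA [bM AM MM]; split; first exact: berk_berk_inv.
- by rewrite join_diam_berk_inv.
- by rewrite /diam join_diam_berk_inv.
Qed.

Lemma is_Qpt_typeI b r : abs b <= 1 -> 0 < r < 1 ->
  is_Qpt (typeI abs b) r (Some (gauss_at b r)).
Proof.
move=> b1 r01; have gP : is_seminorm abs (gauss_at b r) by apply: seminorm_gauss_at; lra.
have nM := @ell_norm (Some (gauss_at b r)) gP; have nA := ell_norm (berk_typeI b).
have ellM u v : ell (Some (gauss_at b r)) u v = Rmax (abs u * r) (abs (u * b + v)).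
  rewrite ell_lform // gauss_at_lform; last lra.
  rewrite /height gauss_atX; last lra.
  have -> : Rmax 1 (Rmax r (abs b)) = 1 by rmax_lra.
  exact: Rdiv_1_r.
have ge : r <= diam (ell (Some (gauss_at b r))).
  apply: diam_ge => // u v uv; rewrite ellM.
  by apply: Rmax_eq1_mul_le; [exact: unit_form_shear | lra].
have le : join_diam (ell (typeI abs b)) (ell (Some (gauss_at b r))) <= r.
  apply: Rle_trans (join_diam_le _ nA (unit_form1N b1)) _.
  rewrite ellM ell_typeI mul1r subrr abs0 abs1 Rdiv_0_l.
  by rmax_lra.
have := diam_le_join_diam (ell (typeI abs b)) nM; rewrite join_diamC => le'.
by split=> //; lra.
Qed.

Lemma ball_lt_of_join_diam A M r X : is_berk abs A -> is_berk abs X -> is_Qpt A r M ->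
  join_diam (ell X) (ell A) < r -> ball_lt abs A r X.
Proof.
move=> bA bX QM lt; have [bQ AQ QQ] := is_Qpt_Qpt bA QM; split.
  apply: median_zetaG_absorb => //; rewrite QQ -AQ.
  have := join_diam_ultrametric (ell_norm bX) (ell_norm bA) (ell_norm bQ).
  by rewrite AQ Rmax_right //; lra.
by move=> e; move: lt; rewrite -e join_diamC AQ; lra.
Qed.

Lemma ballm_of_join_diam A r X : is_berk abs A -> is_berk abs X ->
  (forall s, 0 < s < 1 -> exists M, is_Qpt A s M) -> 0 < r <= 1 ->
  join_diam (ell X) (ell A) < r -> ballm abs A r X.
Proof.
move=> bA bX exQ r01 lt; case: (Rlt_dec r 1) => r1.
  left; split=> //; have [|M QM] := exQ r; first lra.
  exact: ball_lt_of_join_diam QM lt.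
have k0 := join_diam_ge0 (ell A) (ell_norm bX); right; split; first lra.
pose s := (join_diam (ell X) (ell A) + 1) / 2.
have s01 : 0 < s < 1 by rewrite /s; lra.
have [M QM] := exQ s s01; exists s; split=> //.
by apply: ball_lt_of_join_diam QM _ => //; rewrite /s; lra.
Qed.

Lemma join_diam_typeI_le x b : is_seminorm abs x -> abs b <= 1 ->
  join_diam (ell (Some x)) (ell (typeI abs b)) <= x (lin b).
Proof.
move=> xP b1; have nx := @ell_norm (Some x) xP; have x0 := seminorm_ge0 xP (lin b).
apply: Rle_trans (join_diam_le _ nx (unit_form1N b1)) _.
rewrite ell_lin // ell_typeI mul1r subrr abs0 Rdiv_0_l.
apply: Rmax_lub => //; apply/Rle_div_l; first exact: height_gt0.
by have := Rmult_le_compat_l _ _ _ x0 (height_ge1 x); lra.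
Qed.

Definition omits_point f g b r : Prop :=
  exists2 Y, is_berk abs Y &
    forall x, is_seminorm abs x -> x (lin b) < r -> phi_act abs f g (Some x) <> Y.

Lemma B0set_omits_point f g r b : B0set abs f g r -> abs b <= 1 -> omits_point f g b r.
Proof.
move=> [r01 omits] b1; have [|Y [bY omitsY]] := omits (typeI abs b).
  by right; exists b.
exists Y => // x xP xb; apply: omitsY => //; apply: ballm_of_join_diam => //.
- exact: berk_typeI.
- by move=> s s01; exists (Some (gauss_at b s)); exact: is_Qpt_typeI.
- exact: Rle_lt_trans (join_diam_typeI_le xP b1) xb.
Qed.

Lemma B0set_omits_point_rev f g d r b :
  g != 0%ring -> coprimep f g -> d = (maxn (size f) (size g)).-1 ->
  B0set abs f g r -> abs b <= 1 -> omits_point (rev_poly d f) (rev_poly d g) b r.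
Proof.
move=> g0 cop dE [r01 omits] b1; have bt := berk_typeI b.
have [Y [bY omitsY]] := omits (berk_inv (typeI abs b)) (classical_berk_inv b).
exists Y => // x xP xb; rewrite -(phi_berk_inv g0 cop dE xP).
apply: omitsY; first exact: berk_berk_inv.
apply: ballm_of_join_diam => //; try exact: berk_berk_inv.
- move=> s s01; exists (berk_inv (Some (gauss_at b s))).
  by apply: is_Qpt_berk_inv => //; exact: is_Qpt_typeI.
- rewrite join_diam_berk_inv //.
  exact: Rle_lt_trans (join_diam_typeI_le xP b1) xb.
Qed.

(** * An omitted point yields an omitted classical point *)

Lemma abs_gt1_exists : exists c, 1 < abs c.
Proof.
have [c [c0 c1]] := abs_nontrivial.
case: (Rlt_dec 1 (abs c)) => lt; first by exists c.
have cn : c != 0%ring by apply/eqP => e; apply: c0; rewrite e abs0.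
have ac := abs_gt0 cn; exists c^-1%ring; rewrite absV // -[X in X < _]Rinv_1.
by apply: Rinv_0_lt_contravar; lra.
Qed.

Lemma abs_near1_exists r : 1 < r -> exists c, 1 < abs c < r.
Proof.
move=> r1; have [c c1] := abs_gt1_exists.
have [n cn] := pow_gt1_exists (abs c) r1.
case: n cn => [|n] cn; first by move: cn; rewrite /=; lra.
have /closed_rootP [z] : size ('X^(n.+1) - c%:P : {poly K})%ring != 1%N by rewrite size_XnsubC.
rewrite rootE hornerD hornerN hornerC hornerXn subr_eq0 => /eqP zc.
have az : abs z ^ n.+1 = abs c by rewrite -absX zc.
have z0 := abs_ge0 z; exists z; split; apply: Rnot_le_lt => le.
- by have := pow_le1 n.+1 (conj z0 le); lra.
- by have := pow_incr r (abs z) n.+1; lra.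
Qed.

Lemma abs_powerRZ c (n : Z) : c != 0%ring -> exists a, abs a = powerRZ (abs c) n.
Proof.
move=> c0; case: n => [|n|n] /=.
- by exists 1%ring; exact: abs1.
- by exists (c ^+ Pos.to_nat n)%ring; exact: absX.
- by exists (c ^+ Pos.to_nat n)^-1%ring; rewrite absV ?expf_neq0 // absX.
Qed.

Lemma abs_dense_gt0 s r : 0 < s < r -> exists c, s < abs c < r.
Proof.
move=> sr; have rs1 : 1 < r / s by apply/Rlt_div_r; lra.
have [c [c1 cr]] := abs_near1_exists rs1.
have ln_c : 0 < ln (abs c) by rewrite -ln_1; apply: ln_increasing; lra.
have ln_cr : ln (abs c) < ln r - ln s by rewrite -ln_div; try lra; apply: ln_increasing; lra.
have c0 : c != 0%ring by apply/eqP => e; move: c1; rewrite e abs0; lra.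
have [n_gt n_le] := archimed (ln s / ln (abs c)).
move: (up _) n_gt n_le => n n_gt n_le; have [a aE] := abs_powerRZ n c0; exists a.
rewrite aE powerRZ_Rpower /Rpower; last lra.
have lower : ln s < IZR n * ln (abs c) by apply/Rlt_div_l.
have upper : IZR n * ln (abs c) < ln r.
  have : IZR n * ln (abs c) <= (ln s / ln (abs c) + 1) * ln (abs c).
    by apply: Rmult_le_compat_r; lra.
  have -> : (ln s / ln (abs c) + 1) * ln (abs c) = ln s + ln (abs c) by field; lra.
  by lra.
have := exp_increasing _ _ lower; have := exp_increasing _ _ upper.
by rewrite !exp_ln; lra.
Qed.

Lemma abs_dense s r : 0 <= s < r -> exists c, s < abs c < r.
Proof.
move=> sr; have [|c [sc cr]] := @abs_dense_gt0 ((s + r) / 2) r; first lra.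
by exists c; lra.
Qed.

Lemma seq_argmin (F : K -> R) (zs : seq K) :
  exists a, forall z, z \in zs -> F a <= F z.
Proof.
elim: zs => [|c zs [a amin]]; first by exists 0%ring.
case: (Rle_lt_dec (F a) (F c)) => le; [exists a | exists c] => z;
  rewrite inE => /orP[/eqP -> //|/amin]; lra.
Qed.

Lemma seq_gap (F : K -> R) (zs : seq K) s r : s < r ->
  exists2 t, s < t <= r & forall z, z \in zs -> F z <= s \/ t <= F z.
Proof.
move=> sr; elim: zs => [|c zs [t st gap]]; first by exists r => //; lra.
case: (Rle_lt_dec (F c) s) => le.
  by exists t => // z; rewrite inE => /orP[/eqP ->|/gap]; [left|].
have := Rmin_l t (F c); have := Rmin_r t (F c) => minc mint.
exists (Rmin t (F c)) => [|z]; first by split; [apply: Rmin_glb_lt |]; lra.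
by rewrite inE => /orP[/eqP ->|/gap[]]; [right | left | right; lra].
Qed.

Lemma classical_points_dense y (zs : seq K) r : is_seminorm abs y -> 0 < r ->
  exists c, forall z, z \in zs -> Rabs (abs (c - z) - y (lin z)) < r.
Proof.
move=> yP r0; have [a amin] := seq_argmin (fun z => y (lin z)) zs.
have [|t st gap] := @seq_gap (fun z => abs (a - z)) zs (y (lin a)) (y (lin a) + r); first lra.
have [|w [w1 w2]] := @abs_dense (y (lin a)) t; first by have := seminorm_ge0 yP (lin a); lra.
exists (a + w)%ring => z zs_z; have /= az := amin z zs_z.
have yz := seminorm_lin_le yP z a; have az' := abs_sub_le_lin yP a z; have za := absBC a z.
have -> : (a + w - z = (a - z) + w)%ring by rewrite addrAC.
case: (gap z zs_z) => /= gz.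
- rewrite [(_ + w)%ring]addrC absD_eq; last exact: Rle_lt_trans gz w1.
  by apply: Rabs_def1; move: yz az'; rmax_lra.
- rewrite absD_eq; last exact: Rlt_le_trans w2 gz.
  by apply: Rabs_def1; move: yz az'; rmax_lra.
Qed.

Lemma ultrafilter_at y : is_seminorm abs y ->
  exists2 U : set_system K, UltraFilter U &
    forall z, ((fun c => abs (c - z)) @ U --> y (lin z))%classic.
Proof.
move=> yP; pose near (e : seq K * R) : set K :=
  fun c => forall z, z \in e.1 -> Rabs (abs (c - z) - y (lin z)) < e.2.
pose F := filter_from (fun e : seq K * R => 0 < e.2) near.
have FF : Filter F.
  apply: filter_from_filter => [|[zs r] [zs' r'] /= r0 r0'].
    by exists ([::], 1); exact: Rlt_0_1.
  exists (zs ++ zs', Rmin r r') => /= [|c nc]; first exact: Rmin_pos.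
  split=> z zz /=; apply: Rlt_le_trans (nc z _) _; rewrite ?mem_cat ?zz ?orbT //.
  - exact: Rmin_l.
  - exact: Rmin_r.
have PF : ProperFilter F.
  apply: filter_from_proper => -[zs r] /= r0.
  by have [c nc] := classical_points_dense zs yP r0; exists c.
have [U [UU FU]] := ultraFilterLemma PF; exists U => // z.
apply/(@cvgrPdist_lt R R^o) => e /RltP e0; apply: FU.
exists ([:: z], e) => // c /(_ z); rewrite inE eqxx => /(_ isT) /= nc.
by rewrite distrC -RabsE; apply/RltP.
Qed.

Section UltraEvaluation.
Variables (U : set_system K) (w : K -> K) (b : K) (r : R).
Hypothesis ultraU : UltraFilter U.
Hypothesis w_disc : forall c, abs (w c - b) <= r.

Definition ultra_eval h : R := lim ((fun c => abs h.[w c]) @ U)%classic.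

Lemma ultra_eval_cvg h : ((fun c => abs h.[w c]) @ U --> ultra_eval h)%classic.
Proof.
apply/cvg_ex; apply: (ultra_bounded_cvg ultraU (b := gauss_at b r h)) => c.
split; first exact: abs_ge0.
apply: (seminorm_le_gauss_at (seminorm_eval (w c))).
by rewrite hornerXsubC; exact: w_disc.
Qed.

Lemma seminorm_ultra_eval : is_seminorm abs ultra_eval.
Proof.
split=> [h|].
  apply: (ultra_cvg_le ultraU (ultra_cvg_cst ultraU (l := 0)) (@ultra_eval_cvg h)) => c.
  exact: abs_ge0.
split=> [h k|].
  apply: (ultra_cvg_unique ultraU (@ultra_eval_cvg _)).
  rewrite /Pmul; under eq_fun do rewrite hornerM absM.
  by apply: ultra_cvgM; exact: ultra_eval_cvg.
split=> [h k|c].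
  apply: (ultra_cvg_le ultraU (@ultra_eval_cvg _)
    (ultra_cvg_max ultraU (@ultra_eval_cvg h) (@ultra_eval_cvg k))) => c.
  by rewrite /Padd hornerD; exact: absD.
apply: (ultra_cvg_unique ultraU (@ultra_eval_cvg _)).
by rewrite /Pconst; under eq_fun do rewrite hornerC; exact: ultra_cvg_cst.
Qed.

Lemma ultra_eval_lin_le : ultra_eval (lin b) <= r.
Proof.
apply: (ultra_cvg_le ultraU (@ultra_eval_cvg _) (ultra_cvg_cst ultraU (l := r))) => c.
by rewrite hornerXsubC; exact: w_disc.
Qed.

End UltraEvaluation.

(* A point [y] is the limit of the classical points [c] along an ultrafilter; a limit of
   the preimages [w c] is then a preimage of [y]. *)
Lemma phi_hits_of_hits_classical f g b r y : no_common_zero f g -> is_seminorm abs y ->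
  (forall c, exists z, abs (z - b) <= r /\ f.[z]%ring = (c * g.[z])%ring) ->
  exists x, [/\ is_seminorm abs x, x (lin b) <= r & phi_act abs f g (Some x) = Some y].
Proof.
move=> nz yP /choice[w wP]; have [U UU cvgU] := ultrafilter_at yP.
have w_disc c : abs (w c - b) <= r by have [] := wP c.
pose x := ultra_eval U w; have xP : is_seminorm abs x := seminorm_ultra_eval UU w_disc.
exists x; split=> //; first exact: ultra_eval_lin_le.
have x_cvg h := @ultra_eval_cvg U w b r UU w_disc h.
have xE u v : x (pencil f g u v) = y (pencil 'X 1 u v) * x g.
  apply: (ultra_cvg_unique UU (x_cvg _)).
  have -> : (fun c => abs (pencil f g u v).[w c]) =
      (fun c => abs (u * c + v) * abs g.[w c]).
    apply/funext => c; have [_ fw] := wP c.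
    by rewrite -absM !hornerE fw mulrDl mulrA.
  apply: ultra_cvgM => //; rewrite pencil_lform; have [->|u0] := eqVneq u 0%ring.
    rewrite lform0 seminormC //; under eq_fun do rewrite mul0r add0r.
    exact: ultra_cvg_cst.
  rewrite seminorm_lform //; have -> : (fun c => abs (u * c + v)) =
      (fun c => abs u * abs (c - - (v / u))).
    by apply/funext => c; rewrite -absM opprK mulrDr [(u * (v / u))%ring]mulrC divfK.
  by apply: ultra_cvgM => //; exact: ultra_cvg_cst.
have xg : 0 < x g.
  have := xE 1%ring 0%ring; rewrite !pencil10 => xf; have := nz x xP; rewrite xf.
  by case: (seminorm_ge0 xP g) => // <-; rewrite Rmult_0_r Rmax_left; lra.
apply: ell_inj; [exact: berk_phi_Some | by [] | rewrite ell_phi_Some //; last exact: nz].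
symmetry; apply: (pencil_norm_scale xg) => u v; rewrite xE.
by field; lra.
Qed.

Lemma omits_point_zero_free f g b r s : no_common_zero f g -> omits_point f g b r -> s < r ->
  exists u v, unit_form u v /\
    forall z, abs (z - b) <= s -> (pencil f g u v).[z]%ring <> 0%ring.
Proof.
move=> nz [Y bY omitsY] sr; apply: contrapT => none.
have zero u v : unit_form u v ->
    exists z, abs (z - b) <= s /\ (pencil f g u v).[z]%ring = 0%ring.
  move=> uv; apply: contrapT => nozero; apply: none; exists u, v; split=> // z zs pz.
  by apply: nozero; exists z.
case: Y bY omitsY => [y|] bY omitsY; last first.
  have [z [zs gz]] := zero _ _ unit_form01; have zP := seminorm_eval z.
  apply: (omitsY _ zP); first by rewrite hornerXsubC; exact: Rle_lt_trans zs sr.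
  rewrite /phi_act; case: Req_EM_T => // /=.
  by rewrite -(pencil01 f g) gz abs0.
have [|x [xP xb]] := phi_hits_of_hits_classical nz bY (b := b) (r := s); last first.
  by apply: omitsY => //; exact: Rle_lt_trans xb sr.
move=> c; have [|e [e0 _ uv]] := @unit_form_scale 1 (- c); first by rewrite oner_neq0.
have [z [zs hz]] := zero _ _ uv; exists z; split=> //.
move: hz; rewrite -[(1 / e)%ring]mulrC -[(- c / e)%ring]mulrC pencilZ hornerZ => /eqP.
rewrite mulf_eq0 invr_eq0 (negPf e0) /= /pencil scale1r hornerD hornerZ mulNr subr_eq0.
by move=> /eqP.
Qed.

(** * The Lipschitz bound along Gauss points *)

Definition cancel_coef f g i : {poly K} := (f - (f`_i / g`_i) *: g)%ring.

Lemma cancel_coef_coef f g i : (g`_i != 0)%ring -> ((cancel_coef f g i)`_i = 0)%ring.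
Proof. by move=> gi; rewrite coefB coefZ divfK // subrr. Qed.

Lemma cancel_coef_pencil f g i : cancel_coef f g i = pencil f g 1 (- (f`_i / g`_i)).
Proof. by rewrite /pencil scale1r scaleNr. Qed.

Lemma pencil_cancel_coef f g i u v :
  pencil f g u v = pencil (cancel_coef f g i) g u (u * (f`_i / g`_i) + v).
Proof. by rewrite /pencil scalerBr scalerA scalerDl addrA subrK. Qed.

Lemma seminorm_pencil_le x f g u v m : is_seminorm abs x -> abs u <= 1 -> abs v <= 1 ->
  x f <= m -> x g <= m -> x (pencil f g u v) <= m.
Proof.
move=> xP u1 v1 fm gm; apply: Rle_trans (seminormD xP _ _) _; rewrite !seminormZ //.
by have := seminorm_ge0 xP f; have := seminorm_ge0 xP g => *; apply: Rmax_lub; nra.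
Qed.

Lemma gauss_pencil t f g i u v : 0 <= t -> (f`_i = 0)%ring ->
  gauss t g = monomial_norm g t i ->
  gauss t (pencil f g u v) = Rmax (abs u * gauss t f) (abs v * gauss t g).
Proof.
move=> t0 fi gE; have gP := seminorm_gauss t0.
have ge : abs v * gauss t g <= gauss t (pencil f g u v).
  rewrite gE -Rmult_assoc -absM -[(v * g`_i)%ring]add0r -{1}(mulr0 u) -{1}fi -pencil_coef.
  exact: gauss_ge.
have := seminormD gP (u *: f)%ring (v *: g)%ring.
have := seminorm_le_addl gP (u *: f)%ring (v *: g)%ring.
by rewrite !(seminormZ gP) -/(pencil f g u v); move: ge; rmax_lra.
Qed.

Definition dominant_coef f g i t : Prop :=
  gauss t f <= monomial_norm g t i /\ gauss t g <= monomial_norm g t i.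

(* [gauss r h <= abs h`_0] says that [h] has no zero in the open disc of radius [r]. *)
Definition zero_free_member f g r A : Prop :=
  exists u v, [/\ unit_form u v, gauss r (pencil f g u v) <= abs (pencil f g u v)`_0%ring &
    A * Rmax (gauss 1 f) (gauss 1 g) <= abs (pencil f g u v)`_0%ring].

Lemma zero_free_memberC f g r A : zero_free_member f g r A -> zero_free_member g f r A.
Proof.
move=> [u [v [uv zf Azf]]]; exists v, u.
by rewrite pencilC Rmax_comm; split=> //; exact: unit_formC.
Qed.

Section Dominant.
Variables (f g : {poly K}) (i : nat) (t : R).
Hypothesis nz : no_common_zero f g.
Hypothesis t0 : 0 < t.
Hypothesis dom : dominant_coef f g i t.

Let gaussP : is_seminorm abs (gauss t) := seminorm_gauss (Rlt_le _ _ t0).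
Let p : {poly K} := cancel_coef f g i.
Let c : K := (f`_i / g`_i)%ring.

Lemma dominant_gaussE : gauss t g = monomial_norm g t i.
Proof. by apply: Rle_antisym; [case: dom | exact: gauss_ge]. Qed.

Lemma dominant_gauss_gt0 : 0 < gauss t g.
Proof. by have := nz gaussP; rewrite Rmax_right // dominant_gaussE; case: dom. Qed.

Lemma dominant_coef_neq0 : (g`_i != 0)%ring.
Proof.
apply/eqP => gi; have := dominant_gauss_gt0.
by rewrite dominant_gaussE /monomial_norm gi abs0 Rmult_0_l; lra.
Qed.

Lemma dominant_ratio_le1 : abs c <= 1.
Proof.
have gi := abs_gt0 dominant_coef_neq0; have ti : 0 < t ^ i by exact: pow_lt.
rewrite /c absM absV ?dominant_coef_neq0 //; apply/Rle_div_l => //; rewrite Rmult_1_l.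
apply: (Rmult_le_reg_r (t ^ i)) => //; apply: Rle_trans (gauss_ge t f i) _.
by case: dom.
Qed.

Lemma gauss_cancel_coef_le : gauss t p <= gauss t g.
Proof.
rewrite /p cancel_coef_pencil; apply: seminorm_pencil_le => //.
- by rewrite abs1; exact: Rle_refl.
- by rewrite absN; exact: dominant_ratio_le1.
- by rewrite dominant_gaussE; case: dom.
- exact: Rle_refl.
Qed.

Lemma gauss_dominant u v :
  gauss t (pencil f g u v) = Rmax (abs u * gauss t p) (abs (u * c + v) * gauss t g).
Proof.
rewrite (pencil_cancel_coef f g i); apply: (gauss_pencil (i := i)); first exact: Rlt_le.
- exact/cancel_coef_coef/dominant_coef_neq0.
- exact: dominant_gaussE.
Qed.

Lemma dominant_radius_bounds : 0 <= gauss t p / gauss t g <= 1.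
Proof.
have g0 := dominant_gauss_gt0; split; first by apply: Rdiv_le_0_compat => //; exact: gauss_ge0.
by apply/Rle_div_l; rewrite ?Rmult_1_l //; exact: gauss_cancel_coef_le.
Qed.

Lemma pencil_norm_dominant u v : pencil_norm (gauss t) f g u v =
  Rmax (abs u * (gauss t p / gauss t g)) (abs (u * c + v)).
Proof.
have g0 := dominant_gauss_gt0; rewrite /pencil_norm gauss_dominant.
rewrite (Rmax_right (gauss t f)); last by rewrite dominant_gaussE; case: dom.
by rewrite Rmax_div // Rmult_div_l; [congr Rmax; field|]; lra.
Qed.

Lemma dominant_radius_le_diam : gauss t p / gauss t g <= diam (pencil_norm (gauss t) f g).
Proof.
apply: diam_ge => [|u v uv]; first by apply: form_norm_pencil => //; exact: nz.
rewrite pencil_norm_dominant; apply: Rmax_eq1_mul_le; last exact: dominant_radius_bounds.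
exact: unit_form_shear dominant_ratio_le1 uv.
Qed.

End Dominant.

Lemma form_dist_dominant f g i s t : no_common_zero f g -> 0 < s -> 0 < t ->
  dominant_coef f g i s -> dominant_coef f g i t ->
  form_dist (pencil_norm (gauss s) f g) (pencil_norm (gauss t) f g) <=
  Rabs (gauss s (cancel_coef f g i) / gauss s g - gauss t (cancel_coef f g i) / gauss t g).
Proof.
move=> nz s0 t0 doms domt.
have ns : form_norm (pencil_norm (gauss s) f g).
  have sP := seminorm_gauss (Rlt_le _ _ s0); apply: form_norm_pencil => //; exact: nz.
have := join_diam_le (pencil_norm (gauss t) f g) ns
  (unit_form1N (dominant_ratio_le1 nz s0 doms)).
rewrite !(pencil_norm_dominant nz s0 doms, pencil_norm_dominant nz t0 domt).
rewrite mul1r subrr abs0 abs1 !Rmult_1_l.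
have [ys _] := dominant_radius_bounds nz s0 doms.
have [yt _] := dominant_radius_bounds nz t0 domt.
rewrite !(Rmax_left _ 0) //.
have := dominant_radius_le_diam nz s0 doms; have := dominant_radius_le_diam nz t0 domt.
by rewrite /form_dist /Rabs; case: Rcase_abs => ?; rmax_lra.
Qed.

Section ZeroFree.
Variables (f g : {poly K}) (i j : nat) (r A t : R) (us vs : K).
Hypothesis nz : no_common_zero f g.
Hypothesis t0 : 0 < t.
Hypothesis tr : t < r.
Hypothesis A0 : 0 < A.
Hypothesis dom : dominant_coef f g i t.

Let p : {poly K} := cancel_coef f g i.
Let v' : K := (us * (f`_i / g`_i) + vs)%ring.
Let h : {poly K} := pencil f g us vs.

Hypothesis us_vs : unit_form us vs.
Hypothesis zf : gauss r h <= abs h`_0.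
Hypothesis Ah : A * Rmax (gauss 1 f) (gauss 1 g) <= abs h`_0.
Hypothesis pj : gauss t p = monomial_norm p t j.

Let g0 : 0 < gauss t g := dominant_gauss_gt0 nz t0 dom.
Let h_coef (k : nat) : (h`_k = us * p`_k + v' * g`_k)%ring.
Proof. by rewrite /h (pencil_cancel_coef f g i) pencil_coef. Qed.
Let us_v' : unit_form us v' := unit_form_shear (dominant_ratio_le1 nz t0 dom) us_vs.

Lemma zero_free_gt0 : 0 < abs h`_0.
Proof.
apply: Rlt_le_trans Ah; apply: Rmult_lt_0_compat => //.
exact: (nz (seminorm_gauss Rle_0_1)).
Qed.

Lemma zero_free_monomial_lt (k : nat) : (0 < k)%N -> monomial_norm h t k < abs h`_0.
Proof.
case: k => // k _; have tr_k : t ^ k.+1 < r ^ k.+1.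
  apply: (Rle_lt_trans _ (t * r ^ k)); last first.
    by apply: Rmult_lt_compat_r => //; apply: pow_lt; lra.
  by apply: Rmult_le_compat_l; [lra | apply: pow_incr; lra].
have := proj2 (proj1 (gauss_leP _ _ _) zf) k.+1; rewrite /monomial_norm.
case: (abs_ge0 h`_k.+1) => [hk|<- _]; last by rewrite Rmult_0_l; exact: zero_free_gt0.
by have := Rmult_lt_compat_l _ _ _ hk tr_k; lra.
Qed.

Lemma mul_cancel_coef_le (k : nat) : A * abs p`_k <= abs h`_0.
Proof.
apply: Rle_trans Ah; apply: Rmult_le_compat_l; first exact: Rlt_le.
rewrite -monomial_norm1; apply: Rle_trans (gauss_ge _ _ _) _.
rewrite /p cancel_coef_pencil; apply: seminorm_pencil_le.
- exact: seminorm_gauss Rle_0_1.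
- by rewrite abs1; exact: Rle_refl.
- by rewrite absN; exact: dominant_ratio_le1 nz t0 dom.
- exact: Rmax_l.
- exact: Rmax_r.
Qed.

Lemma mul_den_coef_le (k : nat) : A * abs g`_k <= abs h`_0.
Proof.
apply: Rle_trans Ah; apply: Rmult_le_compat_l; first exact: Rlt_le.
rewrite -monomial_norm1; apply: Rle_trans (gauss_ge _ _ _) _.
exact: Rmax_r.
Qed.

Lemma zero_free_radius_le0 : i = 0%N -> A * (gauss t p / gauss t g) <= t ^ j.
Proof.
move=> i0; have p0 : (p`_0 = 0)%ring.
  by rewrite -i0; exact/cancel_coef_coef/(dominant_coef_neq0 nz t0 dom).
have gE : gauss t g = abs g`_0.
  by rewrite (dominant_gaussE dom) i0 /monomial_norm Rmult_1_r.
have h0 : abs h`_0 <= abs g`_0.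
  rewrite h_coef p0 mulr0 add0r absM -[X in _ <= X]Rmult_1_l.
  by apply: Rmult_le_compat_r; [exact: abs_ge0 | case: (unit_form_le1 us_v')].
rewrite Rmult_div_assoc; apply/Rle_div_l => //; rewrite pj gE /monomial_norm.
rewrite -Rmult_assoc [t ^ j * _]Rmult_comm.
apply: Rmult_le_compat_r; first exact/Rlt_le/pow_lt.
exact: Rle_trans (mul_cancel_coef_le j) h0.
Qed.

Hypothesis i0 : (0 < i)%N.

Lemma zero_free_den_lt : abs v' * gauss t g < abs h`_0.
Proof.
rewrite (dominant_gaussE dom) -Rmult_assoc -absM.
have -> : (v' * g`_i = h`_i)%ring; last exact: zero_free_monomial_lt.
by rewrite h_coef cancel_coef_coef ?mulr0 ?add0r //; exact: dominant_coef_neq0 nz t0 dom.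
Qed.

Lemma zero_free_den_monomial_lt (k : nat) : abs (v' * g`_k) * t ^ k < abs h`_0.
Proof.
apply: Rle_lt_trans zero_free_den_lt; rewrite absM Rmult_assoc.
by apply: Rmult_le_compat_l; [exact: abs_ge0 | exact: gauss_ge].
Qed.

Lemma zero_free_gaussE : abs us = 1 /\ gauss t p = abs h`_0.
Proof.
have hE : gauss t h = abs h`_0.
  have := zero_free_gt0 => h0; apply: Rle_antisym.
    apply/gauss_leP; split=> [|[|k]]; first exact: Rlt_le.
      by rewrite /monomial_norm Rmult_1_r; exact: Rle_refl.
    exact/Rlt_le/zero_free_monomial_lt.
  by have := gauss_ge t h 0; rewrite /monomial_norm Rmult_1_r.
have := gauss_dominant nz t0 dom us vs; rewrite -/h hE -/p -/v'.
have := zero_free_den_lt; have := gauss_cancel_coef_le nz t0 dom; rewrite -/p.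
have := gauss_ge0 t p; have [us1 _] := unit_form_le1 us_v'.
case: (unit_form_cases us_v') => ->; rewrite ?Rmult_1_l; first by rmax_lra.
by rmax_lra; nra.
Qed.

Lemma zero_free_index : j = 0%N.
Proof.
case: (posnP j) => // j0; have [us1 pE] := zero_free_gaussE.
have tj : 0 <= t ^ j by apply: pow_le; exact: Rlt_le.
have : abs (us * p`_j) * t ^ j < abs h`_0; last first.
  by rewrite absM us1 Rmult_1_l -pE pj; move=> /Rlt_irrefl.
have -> : (us * p`_j = h`_j - v' * g`_j)%ring by rewrite h_coef addrK.
apply: Rle_lt_trans (Rmult_le_compat_r _ _ _ tj (absB _ _)) _.
rewrite Rmult_max_distr_r //; apply: Rmax_lub_lt; first exact: zero_free_monomial_lt.
exact: zero_free_den_monomial_lt.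
Qed.

Lemma zero_free_radius_le : A * (gauss t p / gauss t g) <= t ^ i.
Proof.
have [_ pE] := zero_free_gaussE.
have [y0 y1] := dominant_radius_bounds nz t0 dom; rewrite -/p in y0 y1.
apply: (Rle_trans _ A).
  by rewrite -[X in _ <= X]Rmult_1_r; apply: Rmult_le_compat_l; lra.
have gi := abs_gt0 (dominant_coef_neq0 nz t0 dom); apply: (Rmult_le_reg_l _ _ _ gi).
apply: (Rle_trans _ (gauss t p)); first by rewrite pE Rmult_comm; exact: mul_den_coef_le.
by have := gauss_cancel_coef_le nz t0 dom; rewrite (dominant_gaussE dom).
Qed.

End ZeroFree.

Lemma zero_free_member_radius_le f g i j (n : nat) r A t :
  no_common_zero f g -> 0 < t < r -> 0 < A -> zero_free_member f g r A ->
  dominant_coef f g i t ->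
  gauss t (cancel_coef f g i) = monomial_norm (cancel_coef f g i) t j ->
  (0 < n)%N -> i = (j + n)%N \/ j = (i + n)%N ->
  A * (gauss t (cancel_coef f g i) / gauss t g) <= t ^ n.
Proof.
move=> nz [t0 tr] A0 [u [v [uv zf Azf]]] dom pj n0 ij; case: (posnP i) => i0.
  have <- : j = n; last exact: zero_free_radius_le0 nz t0 A0 dom uv Azf pj i0.
  by case: ij n0 => [|->]; rewrite i0 // => /esym/eqP; rewrite addn_eq0 => /andP[_ /eqP->].
have j0 := zero_free_index nz t0 tr A0 dom uv zf Azf pj i0.
have <- : i = n; last exact: zero_free_radius_le nz t0 tr A0 dom uv zf Azf i0.
by case: ij i0 => [->|]; rewrite j0 // => /esym/eqP; rewrite addn_eq0 => /andP[/eqP->].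
Qed.

Definition slope_bound (d : nat) r A L : Prop :=
  INR d / r <= L /\ forall n, (0 < n <= d)%N -> INR n / Rpower A (/ INR n) <= L.

Lemma slope_bound_le (d n : nat) (r A L t y : R) : 0 < r -> 0 < A -> slope_bound d r A L ->
  0 < t -> 0 <= y <= 1 -> (0 < n <= d)%N -> (t < r -> A * y <= t ^ n) ->
  INR n * (y / t) <= L.
Proof.
move=> r0 A0 [Lr LA] t0 y01 nd Ay; have [n0 n_d] := andP nd.
case: (Rle_lt_dec r t) => rt.
  apply: Rle_trans Lr; apply: Rmult_le_compat; [exact: pos_INR | | exact: le_nat_INR |].
    by apply: Rdiv_le_0_compat; lra.
  have := Rmult_le_compat_r (/ t) _ _ (Rlt_le _ _ (Rinv_0_lt_compat _ t0)) (proj2 y01).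
  by have := Rinv_le_contravar _ _ r0 rt; rewrite /Rdiv; lra.
apply: Rle_trans (LA n nd); apply: Rmult_le_compat_l; first exact: pos_INR.
by apply: div_le_inv_root => //; exact: Ay.
Qed.

Lemma pow_lipschitz (a L s t : R) (n : nat) : 0 <= a -> 0 < s <= t ->
  INR n * (a * t ^ n / t) <= L -> Rabs (a * s ^ n - a * t ^ n) <= L * (t - s).
Proof.
move=> a0 st slope; have mono : s ^ n <= t ^ n by apply: pow_incr; lra.
have := Rmult_le_compat_l _ _ _ a0 mono => a_mono.
rewrite Rabs_left1; last lra.
apply: Rle_trans (Rmult_le_compat_r (t - s) _ _ _ slope); last lra.
have := Rmult_le_compat_l _ _ _ a0 (pow_sub_le n st).
by rewrite /Rdiv; lra.
Qed.

Lemma inv_pow_lipschitz (a L s t : R) (n : nat) : 0 <= a -> 0 < s <= t ->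
  INR n * (a / s ^ n / s) <= L -> Rabs (a / s ^ n - a / t ^ n) <= L * (t - s).
Proof.
move=> a0 st slope; have mono : / t ^ n <= / s ^ n.
  by apply: Rinv_le_contravar; [apply: pow_lt | apply: pow_incr]; lra.
have := Rmult_le_compat_l _ _ _ a0 mono => a_mono.
rewrite Rabs_right; last by rewrite /Rdiv; lra.
apply: Rle_trans (Rmult_le_compat_r (t - s) _ _ _ slope); last lra.
have := Rmult_le_compat_l _ _ _ a0 (inv_pow_sub_le n st).
by rewrite /Rdiv; lra.
Qed.

Lemma monomial_norm_ratio_up h k i (n : nat) t : 0 < t -> (k`_i != 0)%ring ->
  monomial_norm h t (i + n) / monomial_norm k t i = abs h`_(i + n)%N / abs k`_i * t ^ n.
Proof.
move=> t0 /abs_gt0 ki; have ti : 0 < t ^ i by exact: pow_lt.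
rewrite /monomial_norm -{2}[(i + n)%N]/(i + n)%coq_nat pow_add.
by field; split; lra.
Qed.

Lemma monomial_norm_ratio_down h k i (n : nat) t : 0 < t -> (k`_(i + n) != 0)%ring ->
  monomial_norm h t i / monomial_norm k t (i + n) = abs h`_i / abs k`_(i + n)%N / t ^ n.
Proof.
move=> t0 /abs_gt0 ki; have ti : 0 < t ^ i by exact: pow_lt.
have tn : 0 < t ^ n by exact: pow_lt.
rewrite /monomial_norm -{2}[(i + n)%N]/(i + n)%coq_nat pow_add.
by field; do !split; lra.
Qed.

(* On such a piece [diam_G (phi Q_{0,t})] is a monomial in [t]. *)
Definition monomial_piece f g i j t : Prop := dominant_coef f g i t /\
  gauss t (cancel_coef f g i) <= monomial_norm (cancel_coef f g i) t j.

Section Path.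
Variables (f g : {poly K}) (d : nat) (r A L : R).
Hypothesis nz : no_common_zero f g.
Hypothesis r0 : 0 < r.
Hypothesis A0 : 0 < A.
Hypothesis zf : zero_free_member f g r A.
Hypothesis slopeL : slope_bound d r A L.

Lemma monomial_piece_slope i j (n : nat) t : 0 < t -> monomial_piece f g i j t ->
  (0 < n <= d)%N -> i = (j + n)%N \/ j = (i + n)%N ->
  INR n * (monomial_norm (cancel_coef f g i) t j / monomial_norm g t i / t) <= L.
Proof.
move=> t0 [dom le] nd ij; have [n0 _] := andP nd.
have pj := Rle_antisym _ _ le (gauss_ge _ _ _).
apply: (slope_bound_le r0 A0 slopeL) => //; rewrite -pj -(dominant_gaussE dom).
  exact: dominant_radius_bounds nz t0 dom.
by move=> tr; exact: zero_free_member_radius_le nz (conj t0 tr) A0 zf dom pj n0 ij.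
Qed.

Lemma monomial_piece_form_dist_le i j s t : 0 < s -> 0 < t ->
  monomial_piece f g i j s -> monomial_piece f g i j t ->
  form_dist (pencil_norm (gauss s) f g) (pencil_norm (gauss t) f g) <=
  Rabs (monomial_norm (cancel_coef f g i) s j / monomial_norm g s i -
        monomial_norm (cancel_coef f g i) t j / monomial_norm g t i).
Proof.
move=> s0 t0 [doms les] [domt le_t]; have := form_dist_dominant nz s0 t0 doms domt.
rewrite -(dominant_gaussE doms) -(dominant_gaussE domt).
by rewrite (Rle_antisym _ _ les (gauss_ge _ _ _)) (Rle_antisym _ _ le_t (gauss_ge _ _ _)).
Qed.

Lemma monomial_piece_lipschitz i j s t : (i <= d)%N -> (j <= d)%N -> 0 < s <= t ->
  monomial_piece f g i j s -> monomial_piece f g i j t ->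
  form_dist (pencil_norm (gauss s) f g) (pencil_norm (gauss t) f g) <= L * (t - s).
Proof.
move=> id jd st piece_s piece_t; have [s0 t0] : 0 < s /\ 0 < t by lra.
have gi := dominant_coef_neq0 nz s0 (proj1 piece_s).
apply: Rle_trans (monomial_piece_form_dist_le s0 t0 piece_s piece_t) _.
set p := cancel_coef f g i.
have ratio0 : 0 <= abs p`_j / abs g`_i.
  by apply: Rdiv_le_0_compat; [exact: abs_ge0 | exact: abs_gt0].
have [ji|ij|ji] := ltngtP j i.
- have [n n0 iE] : exists2 n, (0 < n)%N & i = (j + n)%N.
    by exists (i - j)%N; rewrite ?subn_gt0 ?subnKC // ltnW.
  have nd : (0 < n <= d)%N by rewrite n0 (leq_trans _ id) // iE leq_addl.
  have := monomial_piece_slope s0 piece_s nd (or_introl iE).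
  rewrite -/p; move: p ratio0 gi; rewrite iE => p ratio0 gi.
  by rewrite !monomial_norm_ratio_down //; exact: inv_pow_lipschitz.
- have [n n0 jE] : exists2 n, (0 < n)%N & j = (i + n)%N.
    by exists (j - i)%N; rewrite ?subn_gt0 ?subnKC // ltnW.
  have nd : (0 < n <= d)%N by rewrite n0 (leq_trans _ jd) // jE leq_addl.
  have := monomial_piece_slope t0 piece_t nd (or_intror jE).
  rewrite -/p; move: ratio0; rewrite jE => ratio0.
  by rewrite !monomial_norm_ratio_up //; exact: pow_lipschitz.
- rewrite ji /monomial_norm /p cancel_coef_coef // abs0 !Rmult_0_l !Rdiv_0_l.
  rewrite Rminus_0_r Rabs_R0; apply: Rmult_le_pos; last lra.
  case: slopeL => Lr _; apply: Rle_trans Lr.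
  by apply: Rdiv_le_0_compat => //; exact: pos_INR.
Qed.

End Path.

Lemma continuity_monomial_norm h i : continuity (fun t => monomial_norm h t i).
Proof. by move=> t; apply: derivable_continuous_pt; rewrite /monomial_norm; reg. Qed.

Lemma closed_gauss_le h k i : closed_set (fun t => gauss t h <= monomial_norm k t i).
Proof.
have -> : (fun t => gauss t h <= monomial_norm k t i) = (fun t =>
    0 <= monomial_norm k t i /\ forall j, monomial_norm h t j <= monomial_norm k t i).
  by apply/funext => t; apply/propext; exact: gauss_leP.
apply: closed_set_and.
  by apply: closed_set_le; [exact: continuity_const | exact: continuity_monomial_norm].
by apply: closed_set_forall => j; apply: closed_set_le; exact: continuity_monomial_norm.
Qed.

Lemma closed_monomial_piece f g i j : closed_set (monomial_piece f g i j).
Proof. by apply: closed_set_and; [apply: closed_set_and|]; exact: closed_gauss_le. Qed.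

Lemma monomial_piece_exists f g d t : 0 <= t -> (size f <= d.+1)%N -> (size g <= d.+1)%N ->
  gauss t f <= gauss t g ->
  exists i j : 'I_d.+1, monomial_piece f g i j t.
Proof.
move=> t0 sf sg le; have [i id gi] := gauss_attained t0 sg.
have sp : (size (cancel_coef f g i) <= d.+1)%N.
  by rewrite cancel_coef_pencil; exact: size_pencil.
have [j jd pj] := gauss_attained t0 sp.
exists (Ordinal (id : (i < d.+1)%N)), (Ordinal (jd : (j < d.+1)%N)).
by split; [split|]; rewrite /= -?gi -?pj //; exact: Rle_refl.
Qed.

Lemma form_dist_gauss_le f g d r A L s t : no_common_zero f g -> 0 < r -> 0 < A ->
  (size f <= d.+1)%N -> (size g <= d.+1)%N -> zero_free_member f g r A ->
  slope_bound d r A L -> 0 < s <= t ->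
  form_dist (pencil_norm (gauss s) f g) (pencil_norm (gauss t) f g) <= L * (t - s).
Proof.
move=> nz r0 A0 sf sg zf slopeL [s0 st].
pose C (e : bool * ('I_d.+1 * 'I_d.+1)) : R -> Prop :=
  if e.1 then monomial_piece f g e.2.1 e.2.2 else monomial_piece g f e.2.1 e.2.2.
have norm m : 0 < m -> form_norm (pencil_norm (gauss m) f g).
  move=> m0; have mP := seminorm_gauss (Rlt_le _ _ m0).
  by apply: form_norm_pencil => //; exact: nz.
apply: (lipschitz_of_closed_cover
  (D := fun m m' => form_dist (pencil_norm (gauss m) f g) (pencil_norm (gauss m') f g))
  (C := C)) => //.
- by move=> -[[] [i j]]; exact: closed_monomial_piece.
- move=> m smt; have m0 : 0 <= m by lra.
  case: (Rle_lt_dec (gauss m f) (gauss m g)) => [le|/Rlt_le le].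
  + by have [i [j ij]] := monomial_piece_exists m0 sf sg le; exists (true, (i, j)).
  + by have [i [j ij]] := monomial_piece_exists m0 sg sf le; exists (false, (i, j)).
- by move=> m m' smm' m't; apply: form_dist_triangle; apply: norm; lra.
move=> -[b [i j]] m m' smm' m't; have mm' : 0 < m <= m' by lra.
have id : (i <= d)%N := ltn_ord i; have jd : (j <= d)%N := ltn_ord j.
case: b => Cm Cm'; first exact: (monomial_piece_lipschitz nz r0 A0 zf slopeL id jd mm').
have := monomial_piece_lipschitz (no_common_zeroC nz) r0 A0
  (zero_free_memberC zf) slopeL id jd mm' Cm Cm'.
rewrite (pencil_norm_swap (gauss m) f g) (pencil_norm_swap (gauss m') f g).
by rewrite form_dist_swap //; apply: norm; lra.
Qed.

(** * Arbitrary points as limits of discs *)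

Lemma prod_shift_near (I : Type) (ks : seq I) (F : I -> R) m : 0 < m ->
  exists2 e : R, 0 < e &
    \big[Rmult/1]_(i <- ks) (F i + e) < \big[Rmult/1]_(i <- ks) F i + m.
Proof.
move=> m0; pose prod (e : R) := \big[Rmult/1]_(i <- ks) (F i + e).
have prod_cont : continuity_pt prod 0.
  rewrite /prod; elim: ks {prod} => [|i ks IH].
    rewrite (_ : (fun e : R => _) = fun _ => 1); last by apply/funext => e; rewrite big_nil.
    exact: continuity_pt_const.
  rewrite (_ : (fun e : R => _) =
      mult_fct (fun e => F i + e) (fun e => \big[Rmult/1]_(i <- ks) (F i + e))).
    by apply: continuity_pt_mult IH; apply: derivable_continuous_pt; reg.
  by apply/funext => e; rewrite big_cons.
have prod0 : prod 0 = \big[Rmult/1]_(i <- ks) F i.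
  by apply: eq_bigr => i _; rewrite Rplus_0_r.
have [e [e0 near]] := prod_cont m m0; exists (e / 2); first lra.
have : Rabs (prod (e / 2) - prod 0) < m.
  apply: (near (e / 2)); split; first by split=> //; lra.
  by rewrite /= /Rdist Rminus_0_r Rabs_right; lra.
by rewrite prod0 => /Rabs_def2 []; rewrite /prod; lra.
Qed.

Lemma seminorm_near x h m : is_seminorm abs x -> 0 < m ->
  exists2 e : R, 0 < e & forall y, is_seminorm abs y ->
    (forall c, y (lin c) <= x (lin c) + e) -> y h < x h + m.
Proof.
move=> xP m0; have [zs hE] := seminorm_roots h.
have l0 := abs_ge0 (lead_coef h).
have m'0 : 0 < m / (abs (lead_coef h) + 1) by apply: Rdiv_lt_0_compat; lra.
have [e e0 near] := prod_shift_near zs (fun z => x (lin z)) m'0.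
exists e => // y yP yx; rewrite (hE _ yP) (hE _ xP).
have [_ le] := big_Rmult_le zs (fun z => conj (seminorm_ge0 yP (lin z)) (yx z)).
apply: Rle_lt_trans (Rmult_le_compat_l _ _ _ l0 (Rle_trans _ _ _ le (Rlt_le _ _ near))) _.
apply/Rminus_gt_0_lt; rewrite (_ : _ - _ = m / (abs (lead_coef h) + 1)) //.
by field; lra.
Qed.

Lemma seminorm_near_seq x (hs : seq {poly K}) m : is_seminorm abs x -> 0 < m ->
  exists2 e : R, 0 < e & forall y, is_seminorm abs y ->
    (forall c, y (lin c) <= x (lin c) + e) -> forall h, h \in hs -> y h < x h + m.
Proof.
move=> xP m0; elim: hs => [|k hs [e e0 near]]; first by exists 1; [lra|].
have [e' e'0 near_k] := seminorm_near k xP m0.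
have le_e := Rmin_l e e'; have le_e' := Rmin_r e e'.
exists (Rmin e e') => [|y yP ye h]; first exact: Rmin_pos.
rewrite inE => /orP[/eqP->|]; [apply: near_k | apply: near] => // c; have := ye c; lra.
Qed.

Lemma gauss_at_lin_near x c z s m : is_seminorm abs x -> x (lin c) <= s -> s <= radius x + m ->
  0 <= m -> gauss_at c s (lin z) <= x (lin z) + m.
Proof.
move=> xP xc sm m0; rewrite gauss_at_lin; last exact: Rle_trans (seminorm_ge0 xP _) xc.
by have := radius_le z xP; have := abs_sub_le_lin xP c z; rmax_lra.
Qed.

Lemma diam_mul_pencil_le x f g u v : is_seminorm abs x -> 0 < Rmax (x f) (x g) ->
  unit_form u v -> diam (pencil_norm x f g) * Rmax (x f) (x g) <= x (pencil f g u v).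
Proof.
move=> xP m0 uv; apply/Rle_div_r => //.
exact: diam_le (form_norm_pencil xP m0) uv.
Qed.

Section Near.
Variables (x y : {poly K} -> R) (f g : {poly K}) (m : R).
Hypothesis xP : is_seminorm abs x.
Hypothesis yP : is_seminorm abs y.
Hypothesis xy : forall h, x h <= y h.
Hypothesis x0 : 0 < Rmax (x f) (x g).
Hypothesis m0 : 0 < m.

Let xy_max : Rmax (x f) (x g) <= Rmax (y f) (y g).
Proof. by have := xy f; have := xy g; rmax_lra. Qed.

Lemma join_diam_near u v : unit_form u v ->
  y (pencil f g u v) <= x (pencil f g u v) + m * Rmax (x f) (x g) ->
  join_diam (pencil_norm x f g) (pencil_norm y f g) <= pencil_norm x f g u v + m.
Proof.
move=> uv near; apply: Rle_trans (join_diam_le _ (form_norm_pencil xP x0) uv) _.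
apply: Rmax_lub; first lra; rewrite /pencil_norm.
apply: (Rle_trans _ (y (pencil f g u v) / Rmax (x f) (x g))).
  by apply: Rmult_le_compat_l; [exact: seminorm_ge0 | exact: Rinv_le_contravar x0 xy_max].
apply/Rle_div_l => //; rewrite Rmult_plus_distr_r /Rdiv Rmult_assoc Rinv_l; lra.
Qed.

Lemma diam_near : Rmax (y f) (y g) <= Rmax (x f) (x g) + m * Rmax (x f) (x g) ->
  diam (pencil_norm x f g) - m <= diam (pencil_norm y f g).
Proof.
move=> near; have y0 := Rlt_le_trans _ _ _ x0 xy_max.
have nx := form_norm_pencil xP x0.
apply: diam_ge => [|u v uv]; first exact: form_norm_pencil.
apply/Rle_div_r => //; apply: Rle_trans (xy _).
apply: Rle_trans (diam_mul_pencil_le xP x0 uv).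
have := join_diam_le1 nx nx.
by rewrite -/(diam _); nra.
Qed.

End Near.

Lemma form_dist_pencil_near x f g m : is_seminorm abs x -> no_common_zero f g -> 0 < m ->
  exists2 e : R, 0 < e & forall y, is_seminorm abs y -> (forall h, x h <= y h) ->
    (forall c, y (lin c) <= x (lin c) + e) ->
    form_dist (pencil_norm x f g) (pencil_norm y f g) <= m.
Proof.
move=> xP nz m0; have x0 := nz _ xP; have nx := form_norm_pencil xP x0.
have [|u [v [uv uv_near _]]] :=
  join_diam_lt (l2 := pencil_norm x f g) (t := diam (pencil_norm x f g) + m / 4) nx.
  by rewrite /diam; lra.
have m60 : 0 < m / 6 by lra.
have d0 : 0 < m / 6 * Rmax (x f) (x g) by exact: Rmult_lt_0_compat.
have [e e0 near] := seminorm_near_seq [:: f; g; pencil f g u v] xP d0.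
exists e => // y yP xy ye; have {}near := near y yP ye.
have yf : y f < x f + m / 6 * Rmax (x f) (x g) by apply: near; rewrite inE eqxx.
have yg : y g < x g + m / 6 * Rmax (x f) (x g) by apply: near; rewrite !inE eqxx orbT.
have yuv : y (pencil f g u v) < x (pencil f g u v) + m / 6 * Rmax (x f) (x g).
  by apply: near; rewrite !inE eqxx !orbT.
have join := join_diam_near xP yP xy x0 m60 uv (Rlt_le _ _ yuv).
have diam_y : diam (pencil_norm x f g) - m / 6 <= diam (pencil_norm y f g).
  apply: (diam_near xP yP xy x0 m60).
  by apply: Rmax_lub; have := Rmax_l (x f) (x g); have := Rmax_r (x f) (x g); lra.
by rewrite /form_dist; lra.
Qed.

Lemma pencil_norm_gauss_at f g b t : pencil_norm (gauss_at b t) f g =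
  pencil_norm (gauss t) (f \Po ('X + b%:P))%ring (g \Po ('X + b%:P))%ring.
Proof. by apply/funeq2P => u v; rewrite /pencil_norm /gauss_at pencil_comp. Qed.

Lemma abs_center_le1 x b c t : is_seminorm abs x -> abs b <= 1 -> t <= 1 ->
  x (lin b) <= t -> x (lin c) <= t -> abs c <= 1.
Proof.
move=> xP b1 t1 xb xc; have := abs_le_lin xP c.
by have := seminormX_le_lin xP b; rmax_lra.
Qed.

Lemma form_dist_seminorm_gauss f g d (r A L : R) x b t :
  no_common_zero f g -> (size f <= d.+1)%N -> (size g <= d.+1)%N -> 0 < r -> 0 < A ->
  slope_bound d r A L ->
  (forall c, abs c <= 1 ->
    zero_free_member (f \Po ('X + c%:P))%ring (g \Po ('X + c%:P))%ring r A) ->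
  is_seminorm abs x -> abs b <= 1 -> x (lin b) <= t -> 0 < t <= 1 ->
  form_dist (pencil_norm x f g) (pencil_norm (gauss_at b t) f g) <= L * (t - radius x).
Proof.
move=> nz sf sg r0 A0 slopeL zf xP b1 xb [t0 t1].
have rt : radius x <= t := Rle_trans _ _ _ (radius_le b xP) xb.
case: (Rle_lt_dec t (radius x)) => [tr|{}rt].
  by rewrite -(seminorm_eq_gauss_at xP xb tr) form_distxx; have := Rle_antisym _ _ rt tr; nra.
have L0 : 0 <= L.
  by have [Lr _] := slopeL; apply: Rle_trans Lr; apply: Rdiv_le_0_compat => //; exact: pos_INR.
apply: le_epsilon => m m0; have [e e0 near] := form_dist_pencil_near xP nz m0.
have [s [rs st se]] : exists s, [/\ radius x < s, s <= t & s <= radius x + e].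
  by exists (Rmin t (radius x + e)); split;
    [apply: Rmin_glb_lt; lra | exact: Rmin_l | exact: Rmin_r].
have [c xc] := radius_lt xP rs; have s0 : 0 < s by have := radius_ge0 xP; lra.
have c1 : abs c <= 1 by apply: (abs_center_le1 xP b1 t1 xb); lra.
rewrite -(gauss_at_center xP (a := c) (b := b)) //; last lra.
have norm y : is_seminorm abs y -> form_norm (pencil_norm y f g).
  by move=> yP; exact: form_norm_pencil yP (nz _ yP).
have sP := seminorm_gauss_at c (Rlt_le _ _ s0); have tP := seminorm_gauss_at c (Rlt_le _ _ t0).
apply: Rle_trans (form_dist_triangle (norm _ xP) (norm _ sP) (norm _ tP)) _.
have x_s : form_dist (pencil_norm x f g) (pencil_norm (gauss_at c s) f g) <= m.
  apply: near => //; first by apply: seminorm_le_gauss_at => //; lra.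
  by move=> z; apply: gauss_at_lin_near => //; lra.
have s_t : form_dist (pencil_norm (gauss_at c s) f g) (pencil_norm (gauss_at c t) f g) <=
    L * (t - s).
  rewrite !pencil_norm_gauss_at; have nzc := no_common_zero_comp ('X + c%:P)%ring nz.
  apply: (form_dist_gauss_le nzc r0 A0 _ _ (zf c c1) slopeL) => //;
    by rewrite size_comp_poly2 ?size_XaddC.
by nra.
Qed.

Lemma gauss_mul_pow_le h d s : 0 <= s <= 1 -> (size h <= d.+1)%N ->
  gauss 1 h * s ^ d <= gauss s h.
Proof.
move=> s01 sh; have [i id ->] := gauss_attained Rle_0_1 sh.
apply: Rle_trans (gauss_ge s h i); rewrite monomial_norm1 /monomial_norm -(subnKC id).
apply: Rmult_le_compat_l; first exact: abs_ge0.
rewrite -[(i + _)%N]/(i + _)%coq_nat pow_add -{2}(Rmult_1_r (s ^ i)).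
by apply: Rmult_le_compat_l; [apply: pow_le; lra | exact: pow_le1].
Qed.

Lemma gauss_at_unit b : abs b <= 1 -> gauss_at b 1 = gauss 1.
Proof.
move=> b1; rewrite -gauss_at0; have gP := seminorm_gauss_at 0%ring Rle_0_1.
by apply: (gauss_at_center gP); rewrite gauss_at_lin ?sub0r ?subr0 ?absN ?abs0; rmax_lra.
Qed.

Lemma omits_point_zero_free_member f g d b r s : no_common_zero f g ->
  (size f <= d.+1)%N -> (size g <= d.+1)%N -> abs b <= 1 -> omits_point f g b r ->
  0 < s <= 1 -> s < r ->
  zero_free_member (f \Po ('X + b%:P))%ring (g \Po ('X + b%:P))%ring s
    (diam (pencil_norm (gauss 1) f g) * s ^ d).
Proof.
move=> nz sf sg b1 omits s01 sr.
have [u [v [uv zf]]] := omits_point_zero_free nz omits sr.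
have gauss1 h : gauss 1 (h \Po ('X + b%:P))%ring = gauss 1 h.
  by rewrite -[LHS]/(gauss_at b 1 h) gauss_at_unit.
have const : gauss s (pencil f g u v \Po ('X + b%:P))%ring =
    abs (pencil f g u v \Po ('X + b%:P))`_0%ring.
  apply: gauss_zero_free => [|z]; first lra.
  rewrite rootE horner_comp (hornerD 'X) hornerX hornerC => /eqP rz.
  by apply: Rnot_lt_le => lt; apply: (zf (z + b)%ring); rewrite ?addrK //; lra.
exists u, v; rewrite -pencil_comp -const !gauss1; split=> //; first exact: Rle_refl.
apply: Rle_trans (gauss_mul_pow_le (d := d) _ _); last first.
- by rewrite size_comp_poly2 ?size_XaddC //; exact: size_pencil.
- by lra.
have gP := seminorm_gauss Rle_0_1.
rewrite gauss1 Rmult_assoc (Rmult_comm (s ^ d)) -Rmult_assoc.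
apply: Rmult_le_compat_r; first by apply: pow_le; lra.
exact: diam_mul_pencil_le (nz _ gP) uv.
Qed.

Definition lip_const (G r : R) (d : nat) : R :=
  Rmax (1 / (G * r ^ d)) (INR d / (Rpower G (1 / INR d) * r)).

Lemma lip_const_gt0 (G r : R) (d : nat) : 0 < G -> 0 < r -> 0 < lip_const G r d.
Proof.
move=> G0 r0; apply: Rlt_le_trans (Rmax_l _ _).
by apply: Rdiv_lt_0_compat; [lra | apply: Rmult_lt_0_compat => //; exact: pow_lt].
Qed.

Lemma slope_bound_lip_const (G r : R) (d : nat) : 0 < G <= 1 -> 0 < r <= 1 -> (0 < d)%N ->
  slope_bound d r (G * r ^ d) (lip_const G r d).
Proof.
move=> G01 r01 d0; have dR := INR_ge1 d0; have rd : 0 < r ^ d by apply: pow_lt; lra.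
have root0 : 0 < Rpower G (1 / INR d) by exact: exp_pos.
split=> [|n nd].
  apply: Rle_trans (Rmax_r _ _); apply: Rmult_le_compat_l; first lra.
  apply: Rinv_le_contravar; first by apply: Rmult_lt_0_compat; lra.
  have : Rpower G (1 / INR d) <= 1.
    by apply: Rpower_le1 => //; apply: Rdiv_le_0_compat; lra.
  by nra.
have A01 : 0 < G * r ^ d <= 1.
  have r01' : 0 <= r <= 1 by lra.
  by have := pow_le1 d r01'; nra.
apply: Rle_trans (div_root_le A01 nd) _; apply: Req_le; rewrite /lip_const.
congr (Rmax _ (_ / _)).
rewrite -Rpower_mult_distr; try lra.
rewrite -(Rpower_pow d); last lra.
by rewrite Rpower_mult Rinv_r ?Rpower_1; [rewrite /Rdiv Rmult_1_l | lra | lra].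
Qed.

(** * The Lipschitz bound *)

Lemma cancel_coef_neq0 f g i : no_common_zero f g -> (1 < maxn (size f) (size g))%N ->
  cancel_coef f g i != 0%ring.
Proof.
move=> nz sfg; rewrite /cancel_coef subr_eq0; apply/eqP => fE.
case: (eqVneq (size g) 1%N) => [sg|/closed_rootP[z /eqP gz]].
  move: sfg; rewrite sg leq_max ltnn orbF ltnNge => /negP; apply.
  by rewrite fE -sg; exact: size_scale_leq.
have := nz _ (seminorm_eval z).
by rewrite gz {1}fE hornerZ gz mulr0 abs0 Rmax_left; lra.
Qed.

Lemma diam_pencil_gauss1_gt0 f g : no_common_zero f g ->
  (1 < maxn (size f) (size g))%N -> 0 < diam (pencil_norm (gauss 1) f g).
Proof.
wlog le : f g / gauss 1 f <= gauss 1 g => [wlog_le|] nz sfg.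
  case: (Rle_lt_dec (gauss 1 f) (gauss 1 g)) => [|/Rlt_le] le; first exact: wlog_le.
  rewrite -diam_swap -?pencil_norm_swap; last first.
    by have gP := seminorm_gauss Rle_0_1; exact: form_norm_pencil gP (nz _ gP).
  by apply: wlog_le => //; [exact: no_common_zeroC | rewrite maxnC].
have [i _ gi] := gauss_attained Rle_0_1 (leqnSn (size g)).
have dom : dominant_coef f g i 1 by split; rewrite -gi //; exact: Rle_refl.
apply: Rlt_le_trans (dominant_radius_le_diam nz Rlt_0_1 dom).
apply: Rdiv_lt_0_compat (dominant_gauss_gt0 nz Rlt_0_1 dom).
apply: Rlt_le_trans (gauss_ge 1 _ (size (cancel_coef f g i)).-1).
by rewrite monomial_norm1; apply: abs_gt0; rewrite lead_coef_eq0 cancel_coef_neq0.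
Qed.

Lemma diam_radius x : is_seminorm abs x -> x 'X%ring <= 1 -> diam (ell (Some x)) = radius x.
Proof.
move=> xP x1; rewrite -(diamG_diam (P := Some x)) //= /Plin /Kzero subr0.
by rewrite Rmax_left //; field.
Qed.

Lemma berk_disc P b t : is_berk abs P -> abs b <= 1 -> t < 1 ->
  ell P 1%ring (- b)%ring <= t ->
  exists x, [/\ P = Some x, is_seminorm abs x, x (lin b) <= t & x 'X%ring <= 1].
Proof.
case: P => [x|] bP b1 t1; last by rewrite /= abs1; lra.
rewrite ell_lin // => /(Rle_div_l _ _ _ (height_gt0 x)) le; exists x.
have x1 : x 'X%ring <= 1.
  have h1 := height_ge1 x; have lt : x (lin b) < height x by nra.
  by have := seminormX_le_lin bP b; move: lt; rewrite /height; rmax_lra.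
by split=> //; move: le; rewrite /height Rmax_left //; lra.
Qed.

Definition chart (e : bool) P : bpoint K := if e then berk_inv P else P.

Lemma berk_chart e P : is_berk abs P -> is_berk abs (chart e P).
Proof. by case: e => //; exact: berk_berk_inv. Qed.

Lemma chartK e P : is_berk abs P -> chart e (chart e P) = P.
Proof. by case: e => //; exact: berk_invK. Qed.

Lemma chart_zetaG e : chart e (zetaG abs) = zetaG abs.
Proof. by case: e => //; exact: berk_inv_zetaG. Qed.

Lemma diam_chart e P : is_berk abs P -> diam (ell (chart e P)) = diam (ell P).
Proof. by case: e => // bP; exact: join_diam_berk_inv. Qed.

Lemma chart_unit_form u v : unit_form u v -> exists e b, abs b <= 1 /\
  forall P, is_berk abs P -> ell (chart e P) 1%ring (- b)%ring = ell P u v.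
Proof.
have ratio a c : abs a <= 1 -> abs c = 1 -> abs (- (a / c)) <= 1 /\ (c * (a / c) = a)%ring.
  move=> a1 c1; have c0 : c != 0%ring by apply/eqP => c0; move: c1; rewrite c0 abs0; lra.
  by rewrite absN absM absV // c1 Rinv_1 Rmult_1_r mulrC divfK.
move=> uv; have [u1 v1] := unit_form_le1 uv.
case: (unit_form_cases uv) => abs1E.
- have [b1 vE] := ratio v u v1 abs1E; exists false, (- (v / u))%ring; split=> // P bP.
  by rewrite /= opprK -(form_norm_abs1 _ _ (ell_norm bP) abs1E) mulr1 vE.
- have [b1 uE] := ratio u v u1 abs1E; exists true, (- (u / v))%ring; split=> // P bP.
  rewrite /= opprK -(form_norm_abs1 _ _ (ell_norm (berk_berk_inv bP)) abs1E) mulr1 uE.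
  by rewrite ell_berk_inv.
Qed.

Lemma chart_seminorm P : is_berk abs P -> exists e x,
  [/\ is_seminorm abs x, x 'X%ring <= 1 & chart e P = Some x].
Proof.
move=> bP; case: (classic (exists2 x, P = Some x & x 'X%ring <= 1)) => [[x PE x1]|nP].
  by exists false, x; split=> //; move: bP; rewrite PE.
have lt1 : ell (berk_inv P) 1%ring (- 0)%ring < 1.
  rewrite oppr0 ell_berk_inv // /swap.
  case: P bP nP => [x|] bP nP; last by rewrite /= abs0; lra.
  rewrite ell01 // -Rinv_1; apply: Rinv_lt_contravar; first by have := height_gt0 x; lra.
  apply: Rlt_le_trans (le_height x).
  by apply: Rnot_le_lt => x1; apply: nP; exists x.
have b1 : abs 0 <= 1 by rewrite abs0; lra.
have [x [PE xP _ x1]] := berk_disc (berk_berk_inv bP) b1 lt1 (Rle_refl _).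
by exists true, x.
Qed.

Section RationalMap.
Variables (f g : {poly K}) (d : nat) (r s : R).
Hypothesis g0 : g != 0%ring.
Hypothesis cop : coprimep f g.
Hypothesis dE : d = (maxn (size f) (size g)).-1.
Hypothesis d0 : (0 < d)%N.

Let psi P : K -> K -> R := ell (phi_act abs f g P).
Let rev (e : bool) h : {poly K} := if e then rev_poly d h else h.

Lemma form_norm_phi P : is_berk abs P -> form_norm (psi P).
Proof. by move=> bP; exact/ell_norm/berk_phi. Qed.

Lemma no_common_zero_chart e : no_common_zero (rev e f) (rev e g).
Proof. by case: e; [exact: no_common_zero_rev | exact: no_common_zero_coprime]. Qed.

Lemma ell_phi_chart e x : is_seminorm abs x ->
  psi (chart e (Some x)) = pencil_norm x (rev e f) (rev e g).
Proof.
move=> xP; have := no_common_zero_chart e xP; rewrite /psi.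
by case: e => /=; [rewrite (phi_berk_inv g0 cop dE) //|] => /ell_phi_Some ->.
Qed.

Lemma GIR_chart e : GIR abs f g = diam (pencil_norm (gauss 1) (rev e f) (rev e g)).
Proof.
rewrite /GIR diamG_diam; last exact/berk_phi/berk_zetaG.
rewrite -/(psi _) -(chart_zetaG e) /zetaG ell_phi_chart; last exact: seminorm_gauss_norm.
by rewrite gauss_normE.
Qed.

Lemma GIR_bounds : 0 < GIR abs f g <= 1.
Proof.
have nz := no_common_zero_coprime cop; have gP := seminorm_gauss Rle_0_1.
have norm := form_norm_pencil gP (nz _ gP).
rewrite (GIR_chart false); split; last exact: join_diam_le1.
by apply: diam_pencil_gauss1_gt0 => //; move: d0; rewrite dE; case: maxn => [|[]].
Qed.

Hypothesis Br : B0set abs f g r.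
Hypothesis s0 : 0 < s.
Hypothesis sr : s < r.

Let L : R := lip_const (GIR abs f g) s d.

Let s1 : 0 < s <= 1.
Proof. by have [r1 _] := Br; lra. Qed.

Lemma form_dist_phi_disc e x b t : is_seminorm abs x -> abs b <= 1 -> x (lin b) <= t ->
  0 < t <= 1 ->
  form_dist (psi (chart e (Some x))) (psi (chart e (Some (gauss_at b t)))) <=
    L * (t - radius x).
Proof.
move=> xP b1 xb t01; rewrite !ell_phi_chart //; last by apply: seminorm_gauss_at; lra.
have [sf sg] : (size (rev e f) <= d.+1)%N /\ (size (rev e g) <= d.+1)%N.
  by case: (e) => /=; split; rewrite ?size_rev_poly ?(size_num_le dE) ?(size_den_le dE).
have G := GIR_bounds; have nz := no_common_zero_chart e.
have A0 : 0 < GIR abs f g * s ^ d by apply: Rmult_lt_0_compat; [lra | exact: pow_lt].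
apply: (form_dist_seminorm_gauss nz sf sg s0 A0) => // [|c c1].
  exact: slope_bound_lip_const.
rewrite (GIR_chart e); apply: (omits_point_zero_free_member nz sf sg c1 _ s1 sr).
by case: (e); [exact: B0set_omits_point_rev | exact: B0set_omits_point].
Qed.

Lemma form_dist_phi_common u v t : unit_form u v -> 0 < t < 1 ->
  exists2 J, is_berk abs J & forall P, is_berk abs P -> ell P u v <= t ->
    form_dist (psi P) (psi J) <= L * (t - diam (ell P)).
Proof.
move=> uv t01; have [e [b [b1 ellE]]] := chart_unit_form uv.
exists (chart e (Some (gauss_at b t))) => [|P bP].
  by apply/berk_chart/seminorm_gauss_at; lra.
rewrite -ellE // => /(berk_disc (berk_chart e bP) b1 (proj2 t01)) [x [PE xP xb x1]].
rewrite -(diam_chart e bP) PE diam_radius // -{1}(chartK e bP) PE.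
by apply: form_dist_phi_disc => //; lra.
Qed.

Lemma form_dist_phi_zetaG P : is_berk abs P ->
  form_dist (psi P) (psi (zetaG abs)) <= L * (1 - diam (ell P)).
Proof.
move=> bP; have [e [x [xP x1 PE]]] := chart_seminorm bP.
rewrite -(diam_chart e bP) PE diam_radius // -{1}(chartK e bP) PE -(chart_zetaG e) zetaGE.
by apply: form_dist_phi_disc; rewrite ?subr0 ?abs0 //; lra.
Qed.

Lemma form_dist_phi_lt P Q t : is_berk abs P -> is_berk abs Q -> t < 1 ->
  join_diam (ell P) (ell Q) < t ->
  form_dist (psi P) (psi Q) <= L * (2 * t - diam (ell P) - diam (ell Q)).
Proof.
move=> bP bQ t1 lt; have [u [v [uv Pt Qt]]] := join_diam_lt (ell_norm bP) lt.
have t0 : 0 < t by have := join_diam_ge0 (ell Q) (ell_norm bP); lra.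
have [J bJ close] := form_dist_phi_common uv (conj t0 t1).
have [[nP nQ] nJ] := (form_norm_phi bP, form_norm_phi bQ, form_norm_phi bJ).
apply: Rle_trans (form_dist_triangle nP nJ nQ) _.
have := close P bP (Rlt_le _ _ Pt); have := close Q bQ (Rlt_le _ _ Qt).
by rewrite (form_distC _ (psi J)); lra.
Qed.

Lemma form_dist_phi_le P Q : is_berk abs P -> is_berk abs Q ->
  form_dist (psi P) (psi Q) <= L * form_dist (ell P) (ell Q).
Proof.
move=> bP bQ; have L0 : 0 < L := lip_const_gt0 d (proj1 GIR_bounds) s0.
have := join_diam_le1 (ell_norm bP) (ell_norm bQ).
rewrite [form_dist (ell P) _]/form_dist; set k := join_diam _ _ => k1.
case: (Rle_lt_dec 1 k) => lt1.
  have [[nP nQ] nG] := (form_norm_phi bP, form_norm_phi bQ, form_norm_phi berk_zetaG).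
  apply: Rle_trans (form_dist_triangle nP nG nQ) _.
  have := form_dist_phi_zetaG bP; have := form_dist_phi_zetaG bQ.
  by rewrite (form_distC _ (psi (zetaG abs))) (Rle_antisym _ _ k1 lt1); lra.
apply: le_epsilon => m m0; have m_L : 0 < m / (2 * L) by apply: Rdiv_lt_0_compat; lra.
pose t := Rmin ((1 + k) / 2) (k + m / (2 * L)).
have kt : k < t by apply: Rmin_glb_lt; lra.
have t1 : t < 1 by have := Rmin_l ((1 + k) / 2) (k + m / (2 * L)); rewrite -/t; lra.
apply: Rle_trans (form_dist_phi_lt bP bQ t1 kt) _.
have : 2 * L * t <= 2 * L * (k + m / (2 * L)).
  by apply: Rmult_le_compat_l; [lra | exact: Rmin_r].
rewrite (_ : 2 * L * (k + _) = 2 * L * k + m); last by field; lra.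
by lra.
Qed.

End RationalMap.

Lemma pow_mul_lip_const (G r : R) (d : nat) : 0 < G -> 0 < r -> (0 < d)%N ->
  r ^ d * lip_const G r d = Rmax (1 / G) (INR d / Rpower G (1 / INR d) * r ^ d.-1).
Proof.
move=> G0 r0 d0; have rd : 0 < r ^ d by exact: pow_lt.
have root0 : 0 < Rpower G (1 / INR d) by exact: exp_pos.
rewrite /lip_const -RmaxRmult; last lra; congr Rmax; first by field; lra.
by case: d d0 {rd} root0 => // n _ root0; rewrite [n.+1.-1]/= -tech_pow_Rmult; field; lra.
Qed.

Lemma pow_mul_lip_const_le (G r r' : R) (d : nat) : 0 < G -> 0 < r <= r' -> (0 < d)%N ->
  r ^ d * lip_const G r d <= r' ^ d * lip_const G r' d.
Proof.
move=> G0 rr' d0; rewrite !pow_mul_lip_const //; try lra.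
apply: Rle_max_compat_l; apply: Rmult_le_compat_l; last by apply: pow_incr; lra.
by apply: Rdiv_le_0_compat; [exact: pos_INR | exact: exp_pos].
Qed.

Lemma form_dist_phi_le_lub f g d (B0 : R) P Q : g != 0%ring -> coprimep f g ->
  d = (maxn (size f) (size g)).-1 -> (0 < d)%N -> is_lub (B0set abs f g) B0 ->
  is_berk abs P -> is_berk abs Q ->
  form_dist (ell (phi_act abs f g P)) (ell (phi_act abs f g Q)) <=
    lip_const (GIR abs f g) B0 d * form_dist (ell P) (ell Q).
Proof.
move=> g0 cop dE d0 lubB bP bQ.
have B0_gt0 : 0 < B0.
  have [|r Br _] := lub_lt_exists (r := B0 - 1) lubB; first lra.
  by have := proj1 lubB r Br; have [r01 _] := Br; lra.
have G0 := proj1 (GIR_bounds g0 cop dE d0).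
have PQ0 : 0 <= form_dist (ell P) (ell Q) by apply: form_dist_ge0; exact: ell_norm.
set D := form_dist (ell (phi_act _ _ _ _)) _.
suff : B0 ^ d * D <= B0 ^ d * lip_const (GIR abs f g) B0 d * form_dist (ell P) (ell Q).
  by rewrite Rmult_assoc; apply: Rmult_le_reg_l; exact: pow_lt.
apply: (le_of_left_continuous (F := fun r => r ^ d * D)) => // [|s [s0 sB]].
  by apply: derivable_continuous_pt; reg.
have [r Br sr] := lub_lt_exists lubB sB.
have le := form_dist_phi_le g0 cop dE d0 Br s0 sr bP bQ.
apply: Rle_trans (Rmult_le_compat_l _ _ _ (pow_le s d (Rlt_le _ _ s0)) le) _.
rewrite -Rmult_assoc; apply: Rmult_le_compat_r => //.
by apply: pow_mul_lip_const_le => //; lra.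
Qed.

End BerkovichLine.

Theorem theorem2 (K : closedFieldType) (abs : K -> R)
  (Habs : nonarch_complete_abs abs)
  (f g : {poly K}) (d : nat)
  (Hg : g != @GRing.zero _) (Hcop : coprimep f g)
  (Hd : d = (maxn (size f) (size g)).-1) (Hd1 : leq 1 d)
  (B0 : R) (HB0 : is_lub (B0set abs f g) B0) :
  forall X Y : bpoint K, is_berk abs X -> is_berk abs Y -> X <> Y ->
    berk_dist abs (phi_act abs f g X) (phi_act abs f g Y) <=
    Rmax (1 / (GIR abs f g * B0 ^ d))
         (INR d / (Rpower (GIR abs f g) (1 / INR d) * B0)) * berk_dist abs X Y.
Proof.
move=> X Y berkX berkY _.
have [berk_phiX berk_phiY] := (berk_phi Habs f Hg berkX, berk_phi Habs f Hg berkY).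
rewrite !(berk_dist_ell Habs) //.
exact: (form_dist_phi_le_lub Habs Hg Hcop Hd Hd1 HB0 berkX berkY).
Qed.
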